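(* Let $S$ be a Seidel matrix of order $n\geqslant277$ with $\lambda_{\min}(S)=-5$ and $\omega([S])=4$. If $\alpha([S])\geqslant39$, then $\operatorname{rk}(S+5\mathbf{I})\geqslant\frac{2n}{3}+1$.
   Context: All graphs are finite, simple, undirected. A Seidel matrix of order $n$ is a real symmetric $n\times n$ matrix with zero diagonal and off-diagonal entries in $\{\pm1\}$; its graph $G(S)$ has vertex set $\{1,\dots,n\}$ with $i\sim j$ iff $S_{ij}=-1$. The switching graph $\mathcal{Sw}(S)$ is the graph $G(S')$ of the Seidel matrix $S'=\begin{pmatrix}S&-S+\mathbf{I}\\-S+\mathbf{I}&S\end{pmatrix}$ of order $2n$. Define $\alpha([S]):=\alpha(\mathcal{Sw}(S))$ (independence number) and $\omega([S]):=\omega(\mathcal{Sw}(S))$ (clique number). $\lambda_{\min}$ is the smallest eigenvalue, $\operatorname{rk}$ the rank. *)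

(* Defs.v *)
From HB Require Import structures.
From mathcomp Require Import all_boot all_order all_algebra.
From mathcomp Require Import reals.

Set Implicit Arguments.
Unset Strict Implicit.
Unset Printing Implicit Defensive.

Import Order.TTheory GRing.Theory Num.Theory.
Local Open Scope ring_scope.

(* A simple graph on a finite type is given by its adjacency relation. *)
Section Graphs.
Variables (T : finType) (e : rel T).

Definition is_clique (A : {set T}) : bool :=
  [forall x in A, forall y in A, (x != y) ==> e x y].

Definition is_independent (A : {set T}) : bool :=
  [forall x in A, forall y in A, ~~ e x y].

Definition clique_number : nat := \max_(A : {set T} | is_clique A) #|A|.

Definition independence_number : nat :=
  \max_(A : {set T} | is_independent A) #|A|.

End Graphs.

Section Seidel.
Variables (R : realType) (n : nat).
Implicit Type S : 'M[R]_n.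

Definition is_Seidel S : Prop :=
  [/\ S^T = S,
      forall i, S i i = 0 &
      forall i j, i != j -> S i j = 1 \/ S i j = -1].

Definition seidel_graph S : rel 'I_n := fun i j => S i j == -1.

Definition switching_mx S : 'M[R]_(n + n) :=
  block_mx S (- S + 1%:M) (- S + 1%:M) S.

(* MathComp's [eigenvalue] acts on row vectors; left and right eigenvalues of
   a square matrix coincide. *)
Definition smallest_eigenvalue S (a : R) : Prop :=
  eigenvalue S a /\ forall b : R, eigenvalue S b -> a <= b.

End Seidel.

Definition switching_graph (R : realType) (n : nat) (S : 'M[R]_n) :
  rel 'I_(n + n) := seidel_graph (switching_mx S).

Definition class_alpha (R : realType) (n : nat) (S : 'M[R]_n) : nat :=
  independence_number (switching_graph S).

Definition class_omega (R : realType) (n : nat) (S : 'M[R]_n) : nat :=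
  clique_number (switching_graph S).

(* Main.v *)
Require Import Defs.
From HB Require Import structures.
From mathcomp Require Import all_boot all_order all_algebra.
From mathcomp Require Import reals.
From mathcomp Require Import boolp complex.
From mathcomp Require Import zify ring lra.

(* After switching, let G be the graph whose edges are the entries -1 of S, with
   adjacency matrix B.  Then S + 5I = J + 2Q with Q = 2I - B, so Q is nonnegative
   on vectors of sum 0.  If u >= 0 is a nonzero vector supported on F with
   u^T Q u <= 0 (for instance the null vector of an affine Dynkin diagram mapped
   into G), then correcting by a multiple of u shows that Q is positive
   semidefinite off the closed neighbourhood N[F].  A connected graph without
   triangles that carries a null vector of a positive semidefinite Q has at
   least 4 vertices, so the nullity of S + 5I is at most
   |N[F]| + (n - |N[F]|) / 4, which suffices as soon as |N[F]| <= 29; triangles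
   off N[F] are excluded by omega([S]) = 4, since a triangle and an edge that
   are disjoint and nonadjacent switch to a 5-clique.

   Let A be a maximum independent set, |A| >= 39.  Each vertex off A is switched
   to have at most |A| / 2 neighbours in A; testing S + 5I on vectors eliminating
   A gives 1 to 5 neighbours, and bounds the degrees of G.  If some vertex off A
   has 5 neighbours in A, its star gives u^T Q u < 0 and a cruder bound on N[F]
   is enough.  If some vertex off A has 4, its star in A is a suitable F.
   Otherwise all degrees are at most 6, and a triangle or a star K_{1,4} is a
   suitable F; without these all degrees are at most 3, and either a small
   affine Dynkin diagram maps into G by a local injection, or each component is
   small or a subgraph of an affine diagram of type A or D, so that Q itself is
   positive semidefinite. *)

Set Implicit Arguments.
Unset Strict Implicit.
Unset Printing Implicit Defensive.

Import Order.TTheory GRing.Theory Num.Theory.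
Local Open Scope ring_scope.

(** * The forms of Q and J + 2Q, and null vectors off a closed neighbourhood *)

Section QuadraticForms.
Variables (R : realFieldType) (T : finType) (e : rel T).
Hypotheses (e_sym : symmetric e) (e_irr : irreflexive e).
Implicit Types (x y u : T -> R) (F U W : {set T}) (v : T).

(* For the adjacency matrix B of [e], [qform] is the form of Q = 2I - B and
   [pform] that of J + 2Q. *)
Definition bform x y : R :=
  2 * (\sum_v x v * y v) - \sum_v \sum_(w | e v w) x v * y w.
Definition qform x : R := bform x x.
Definition pform x : R := (\sum_v x v) ^+ 2 + 2 * qform x.
Definition supported F x := forall v, v \notin F -> x v = 0.
Definition nb v : {set T} := [set w | e v w].
Definition clnb F : {set T} := F :|: \bigcup_(v in F) nb v.
Definition psd_on F := forall x, supported F x -> 0 <= qform x.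
Definition triangle_free_on F :=
  forall a b c, a \in F -> b \in F -> c \in F -> ~~ [&& e a b, e b c & e c a].

Lemma bformC x y : bform x y = bform y x.
Proof.
rewrite /bform; congr (_ * _ - _); first by apply: eq_bigr => v _;
  rewrite mulrC.
rewrite (exchange_big_dep predT) //=; apply: eq_bigr => v _.
by apply: eq_big => [w|w _]; rewrite 1?e_sym // mulrC.
Qed.

Lemma bformDl x x' y : bform (fun v => x v + x' v) y = bform x y + bform x' y.
Proof.
rewrite /bform; set s1 := \sum_v x v * y v; set s2 := \sum_v x' v * y v.
have -> : \sum_v (x v + x' v) * y v = s1 + s2.
  by rewrite -big_split; apply: eq_bigr => v _; rewrite mulrDl.
have -> : \sum_v \sum_(w | e v w) (x v + x' v) * y w =
   \sum_v \sum_(w | e v w) x v * y w + \sum_v \sum_(w | e v w) x' v * y w.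
  rewrite -big_split; apply: eq_bigr => v _.
  by rewrite -big_split; apply: eq_bigr => w _; rewrite mulrDl.
ring.
Qed.

Lemma bformZl k x y : bform (fun v => k * x v) y = k * bform x y.
Proof.
rewrite /bform; have -> : \sum_v k * x v * y v = k * \sum_v x v * y v.
  by rewrite big_distrr /=; apply: eq_bigr => v _; rewrite mulrA.
have -> : \sum_v \sum_(w | e v w) k * x v * y w =
   k * \sum_v \sum_(w | e v w) x v * y w.
  rewrite big_distrr /=; apply: eq_bigr => v _; rewrite big_distrr /=.
  by apply: eq_bigr => w _; rewrite mulrA.
ring.
Qed.

Lemma qform_comb k x y :
  qform (fun v => x v + k * y v) = qform x + 2 * k * bform x y + k ^+ 2 * qform
    y.
Proof.
rewrite /qform bformDl bformZl ![bform _ (fun _ => _ + _)]bformC !bformDl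
  !bformZl.
rewrite (bformC y x); ring.
Qed.

Lemma eq_qform x y : x =1 y -> qform x = qform y.
Proof.
move=> xy; rewrite /qform /bform; congr (_ * _ - _).
  by apply: eq_bigr => v _; rewrite xy.
by apply: eq_bigr => v _; apply: eq_bigr => w _; rewrite !xy.
Qed.

Lemma bform_disjoint F x y :
  supported F x -> supported (~: clnb F) y -> bform x y = 0.
Proof.
move=> xF yF.
have x0 v w : v \in clnb F -> x w * y v = 0.
  by move=> vF; rewrite yF ?mulr0 // inE negbK.
rewrite /bform !big1 ?mulr0 ?subr0 // => v _.
  apply: big1 => w evw.
  have [vF|vF] := boolP (v \in F); last by rewrite xF ?mul0r.
  by rewrite x0 // !inE; apply/orP; right; apply/bigcupP; exists v;
    rewrite ?inE.
have [vF|vF] := boolP (v \in F); last by rewrite xF ?mul0r.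
by rewrite x0 // !inE vF.
Qed.

(** The off-diagonal entries of Q are nonpositive, so absolute values keep the diagonal part and can
    only lower the rest. This lets null vectors be taken nonnegative. *)
Lemma qform_abs x : qform (fun v => `|x v|) <= qform x.
Proof.
rewrite /qform /bform; apply: lerB.
  by rewrite ler_pM2l //; apply: ler_sum => v _;
    rewrite -normrM ger0_norm // -expr2 sqr_ge0.
by do 2!apply: ler_sum => ? _; rewrite -normrM ler_norm.
Qed.

Lemma supported_abs F x : supported F x -> supported F (fun v => `|x v|).
Proof. by move=> xF v vF; rewrite xF ?normr0. Qed.

Section Psd.
Hypothesis psdP : forall x, 0 <= pform x.

(* The combination of [x] and [u] whose coordinates sum to 0 kills the rank-one
   part of [pform]. *)
Lemma qform_outside F u x : supported F u -> 0 < \sum_v u v ->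
  supported (~: clnb F) x ->
  0 <= qform x + (- (\sum_v x v) / (\sum_v u v)) ^+ 2 * qform u.
Proof.
move=> uF u0 xF; set k := - _ / _.
have := psdP (fun v => x v + k * u v).
rewrite /pform big_split -big_distrr /= qform_comb bformC (bform_disjoint uF
  xF).
rewrite mulr0 addr0 /k divfK ?gt_eqF // subrr expr0n /= add0r.
by rewrite pmulr_rge0.
Qed.

Lemma psd_outside F u : supported F u -> 0 < \sum_v u v -> qform u <= 0 ->
  psd_on (~: clnb F).
Proof.
move=> uF u0 qu x xF; have := qform_outside uF u0 xF.
by move/le_trans; apply; rewrite gerDl mulr_ge0_le0 ?sqr_ge0.
Qed.

(** Strictness comes from applying [qform_outside] to the absolute values of [x]: their sum is
    positive unless [x] vanishes, so the multiple of [u] is nonzero and contributes a negative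
    amount. *)
Lemma pos_outside F u x : supported F u -> 0 < \sum_v u v -> qform u < 0 ->
  supported (~: clnb F) x -> qform x <= 0 -> forall v, x v = 0.
Proof.
move=> uF u0 qu xF qx v; apply/eqP/negPn/negP => xv0.
have sx : 0 < \sum_v `|x v|.
  rewrite (bigD1 v) //= ltr_wpDr ?normr_gt0 //.
  by apply: sumr_ge0 => w _.
have := qform_outside uF u0 (supported_abs xF); apply/negP; rewrite -ltNge.
rewrite -[X in _ < X](addr0 0) ler_ltD ?(le_trans (qform_abs x)) //.
by rewrite pmulr_rlt0 // exprn_even_gt0 //= mulf_neq0 ?oppr_eq0 ?invr_eq0
  ?gt_eqF.
Qed.

End Psd.

Lemma bform_delta x v :
  bform x (fun w => (w == v)%:R) = 2 * x v - \sum_(w in nb v) x w.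
Proof.
rewrite bformC /bform (bigD1 v) //= eqxx mul1r big1 ?addr0 => [|w /negPf->];
  last by rewrite mul0r.
rewrite (bigD1 v) //= [X in _ - (_ + X)]big1 ?addr0 => [|w /negPf->];
  last by rewrite big1 // => z _; rewrite mul0r.
congr (_ - _); apply: eq_big => [w|w _]; by rewrite ?inE ?eqxx ?mul1r.
Qed.

Lemma qform_delta v : qform (fun w => (w == v)%:R) = 2.
Proof.
rewrite /qform bform_delta eqxx mulr1 big1 ?subr0 // => w.
by rewrite inE; case: eqP => // ->; rewrite e_irr.
Qed.

(** A null vector minimises a semidefinite form, so the derivative in the direction of each vertex
    of [F] vanishes. *)
Lemma null_harmonic F x : psd_on F -> supported F x -> qform x = 0 ->
  forall v, v \in F -> 2 * x v = \sum_(w in nb v) x w.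
Proof.
move=> psdF xF qx v vF; apply/eqP; rewrite -subr_eq0 -bform_delta.
set b := bform _ _.
(* The coefficient k = [- b / 2] minimises 2kb + 2k^2, with minimum - b^2 / 2. *)
have : 0 <= qform (fun w => x w + (- b / 2) * (w == v)%:R).
  apply: psdF => w wF; rewrite xF //.
  have -> : (w == v) = false by apply: contraNF wF => /eqP->.
  by rewrite mulr0 addr0.
rewrite qform_comb qx qform_delta -/b => h.
by rewrite -sqrf_eq0 eq_le sqr_ge0 andbT; nra.
Qed.

Section NullSupport.
Variables (F : {set T}).
Hypotheses (psdF : psd_on F) (tfF : triangle_free_on F).

Let eF : rel T := fun v w => [&& v \in F, w \in F & e v w].

Let eFsym : connect_sym eF.
Proof. by apply: sym_connect_sym => v w; rewrite /eF e_sym andbCA. Qed.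

Let comp v : {set T} := [set w | connect eF v w].
(** Only components with at least four vertices can carry a null vector, and there vanishing at a
    single vertex, the root, is enough. *)
Let H : {set T} := [set v in F | (fingraph.root eF v == v) && (4 <= #|comp
  v|)%N].

Let compF v : v \in F -> comp v \subset F.
Proof.
move=> vF; apply/subsetP => w; rewrite inE => /connectP[p pth ->].
case/lastP: p pth => [|p z] //; rewrite rcons_path last_rcons.
by case/andP=> _ /and3P[].
Qed.

Let sum_nbF x v : supported F x ->
  \sum_(w in nb v) x w = \sum_(w in nb v :&: F) x w.
Proof.
move=> xF; rewrite (bigID (mem F)) /= [X in _ + X]big1 ?addr0 => [|w /andP[_
  /xF] //].
by apply: eq_bigl => w; rewrite !inE.
Qed.

Lemma card_null_roots : (4 * #|H| <= #|F|)%N.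
Proof.
have -> : (4 * #|H| = \sum_(v in H) 4)%N by rewrite sum_nat_const mulnC.
have tr : trivIset [set comp v | v in H].
  apply/trivIsetP => _ _ /imsetP[v vH ->] /imsetP[w wH ->] vw.
  rewrite -setI_eq0; apply/eqP/setP => z; rewrite !inE;
    apply/negP=> /andP[vz wz].
  case/negP: vw; move: vH wH;
    rewrite !inE => /andP[_ /andP[/eqP rv _]] /andP[_ /andP[/eqP rw _]].
  have : connect eF v w by rewrite (connect_trans vz) // eFsym.
  by move/(fingraph.rootP eFsym); rewrite rv rw => ->.
have inj : {in H &, injective comp}.
  move=> v w;
    rewrite !inE => /andP[_ /andP[/eqP rv _]] /andP[_ /andP[/eqP rw _]]
      /setP/(_ w).
  rewrite !inE connect0 => /(fingraph.rootP eFsym); by rewrite rv rw.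
have : (#|cover [set comp v | v in H]| <= #|F|)%N.
  apply/subset_leq_card/bigcupsP => _ /imsetP[v vH ->].
  by apply: compF; move: vH; rewrite inE => /andP[].
rewrite -(eqP tr) big_imset //=; apply: leq_trans; apply: leq_sum => v.
by rewrite inE => /andP[_ /andP[]].
Qed.

(** By [qform_abs] the absolute value of a null vector is null too, hence nonnegative and harmonic,
    and its zeros spread along edges through the whole component. Components with at most three
    vertices admit only the zero vector. *)
Lemma null_roots x : supported F x -> qform x = 0 ->
  (forall v, v \in H -> x v = 0) -> forall v, x v = 0.
Proof.
move=> xF qx xH v.
pose y w := `|x w|; have yF : supported F y := supported_abs xF.
have y0 w : 0 <= y w by rewrite /y.
suff: y v = 0 by move/eqP; rewrite normr_eq0 => /eqP.
have qy : qform y = 0.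
  by apply/eqP; rewrite eq_le psdF // andbT -qx qform_abs.
have har w : w \in F -> 2 * y w = \sum_(z in nb w :&: F) y z.
  by move=> wF; rewrite (null_harmonic psdF yF qy) // sum_nbF.
have [vF|/yF //] := boolP (v \in F).
have step w z : eF w z -> y w = 0 -> y z = 0.
  case/and3P=> wF zF wz yw; have := har _ wF; rewrite yw mulr0 => /esym/eqP.
  rewrite psumr_eq0 // => /allP/(_ z); rewrite mem_index_enum => /(_ isT).
  by rewrite !inE wz zF => /eqP.
have conn w z : connect eF w z -> y w = 0 -> y z = 0.
  case/connectP=> p; elim: p w => [w _ -> //|a p IH w /= /andP[wa pa] zl] yw.
  by apply: (IH a pa zl); apply: step wa yw.
have [big|small] := leqP 4 #|comp v|.
  apply: (conn (fingraph.root eF v)); first by rewrite eFsym connect_root.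
  apply/eqP; rewrite normr_eq0; apply/eqP/xH;
    rewrite inE (root_root eFsym) eqxx /=.
  have vr : fingraph.root eF v \in comp v by rewrite inE connect_root.
  rewrite (subsetP (compF vF)) //=;
    suff -> : comp (fingraph.root eF v) = comp v by [].
  by apply/setP=> z; rewrite !inE -(same_connect eFsym (connect_root eF v)).
have vC : v \in comp v by rewrite inE connect0.
(* In a component with at most three vertices and no triangle, a vertex where a
   nonnegative null vector is maximal would have two nonadjacent neighbours
   carrying the same value, each of degree one. *)
have [m mC mmax] : exists2 m, m \in comp v & forall w, w \in comp v -> y w <= y
  m.
  by case: (arg_maxP y vC) => m mC mmax; exists m.
have mF : m \in F := subsetP (compF vF) _ mC.
have [ym|ym] := eqVneq (y m) 0; first by apply/eqP;
  rewrite eq_le y0 andbT -ym mmax.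
have ymp : 0 < y m by rewrite lt_def ym y0.
have nbC w : w \in comp v -> nb w :&: F \subset comp v :\ w.
  move=> wC; apply/subsetP => z; rewrite !inE => /andP[wz zF].
  have -> : z != w by apply: contraTneq wz => ->; rewrite e_irr.
  rewrite /= (connect_trans (y := w)) //; first by move: wC; rewrite inE.
  by apply: connect1; rewrite /eF wz zF (subsetP (compF vF)).
have cardC w : w \in comp v -> (#|comp v :\ w| <= 2)%N.
  by move=> wC; move: small; rewrite (cardsD1 w) wC.
(* By harmonicity, twice the positive maximum is a sum of neighbouring values, none above the
   maximum. *)
have deg2 : (2 <= #|nb m :&: F|)%N.
  rewrite -(ler_nat R) -(ler_pM2r ymp) har // mulr_natl -sumr_const.
  by apply: ler_sum => w /(subsetP (nbC _ mC)); rewrite inE => /andP[_ /mmax].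
have eqC : nb m :&: F = comp v :\ m.
  by apply/eqP; rewrite eqEcard nbC // (leq_trans (cardC _ mC)).
have /cards2P[a [b [ab nmE]]] : #|nb m :&: F| == 2%N.
  by rewrite eqn_leq deg2 andbT eqC cardC.
have inm w : w \in [set a; b] -> [/\ w \in F, e m w & w \in comp v].
  move=> wab; have : w \in nb m :&: F by rewrite nmE.
  rewrite !inE => /andP[mw wF]; split => //.
  by have := subsetP (nbC _ mC) w; rewrite nmE wab => /(_ isT);
    rewrite !inE => /andP[].
have [aF ma aC] := inm a (set21 _ _); have [bF mb bC] := inm b (set22 _ _).
have nbm w : w \in [set a; b] -> 2 * y w <= y m.
  move=> wab; have [wF mw wC] := inm w wab.
  rewrite har //; suff -> : nb w :&: F = [set m] by rewrite big_set1.
  apply/setP => z; rewrite !inE; apply/andP/eqP => [[wz zF]|->];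
    last by rewrite e_sym.
    apply/eqP; apply: contraT => zm.
    have : z \in [set a; b].
      rewrite -nmE eqC; have := subsetP (nbC _ wC) z;
        rewrite !inE wz zF zm /= => /(_ isT).
      by case/andP.
    rewrite !inE => zab; move: wab; rewrite !inE.
    have abx : ~~ e a b by have := tfF mF aF bF; rewrite ma (e_sym b) mb andbT.
    by case/orP: zab wz => /eqP-> + /orP[]/eqP E;
      rewrite E ?e_irr // ?(negPf abx) // e_sym (negPf abx).
have := har _ mF; rewrite nmE big_setU1 ?inE //= big_set1.
move: (nbm a (set21 _ _)) (nbm b (set22 _ _)) => h1 h2 h3; lra.
Qed.

End NullSupport.

Lemma null_hitting F : psd_on F -> triangle_free_on F ->
  exists2 H : {set T}, (4 * #|H| <= #|F|)%N &
    forall x, supported F x -> qform x = 0 ->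
    (forall v, v \in H -> x v = 0) -> forall v, x v = 0.
Proof.
move=> psdF tfF; eexists; first exact: (card_null_roots F).
exact: null_roots.
Qed.

(** A null vector is determined by its values on [H], so the nullity is at most [#|H|]; the
    inequality on cardinals then gives rank at least 2n/3 + 1. *)
Definition small_nullity :=
  exists2 H : {set T}, (3 * #|H| + 3 <= #|T|)%N &
    forall x, pform x = 0 -> (forall v, v \in H -> x v = 0) -> forall v, x v =
      0.

(** With u = [#|U|], the hitting set [U :|: H] has at most u + (n - u) / 4 elements, so 9u + 12 <= n
    is wanted; for u = 29 this reads 273 <= n. *)
Lemma small_nullity_psd U : (277 <= #|T|)%N -> (#|U| <= 29)%N ->
  psd_on (~: U) -> triangle_free_on (~: U) -> small_nullity.
Proof.
move=> n277 U29 psdU tfU; have [H cH Hx] := null_hitting psdU tfU.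
exists (U :|: H) => [|x px xUH].
  by have := cardsC U; have := leq_card_setU U H; case=> + _; lia.
have xU : supported (~: U) x.
  by move=> v; rewrite inE negbK => vU; apply: xUH; rewrite inE vU.
apply: Hx => // [|v vH]; last by apply: xUH; rewrite inE vH orbT.
by have := psdU x xU; move: px; rewrite /pform; have := sqr_ge0 (\sum_v x v);
  lra.
Qed.

(** By [pos_outside] a null vector vanishing on [clnb F] is zero, so [clnb F] itself is the hitting
    set, and 3 * 91 + 3 = 276. *)
Lemma small_nullity_strict F u : (277 <= #|T|)%N -> (forall x, 0 <= pform x) ->
  (#|clnb F| <= 91)%N -> supported F u -> 0 < \sum_v u v -> qform u < 0 ->
  small_nullity.
Proof.
move=> n277 psdP F91 uF u0 qu; exists (clnb F) => [|x px xF]; first lia.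
apply: (pos_outside psdP uF u0 qu).
  by move=> v; rewrite inE negbK => vU; apply: xF.
by move: px; rewrite /pform; have := sqr_ge0 (\sum_v x v); lra.
Qed.

End QuadraticForms.

(** * Criteria for semidefiniteness, and nonnegative vectors pushed forward from affine diagrams *)

Section Certificates.
Variables (R : realFieldType) (T : finType) (e : rel T).
Hypothesis e_sym : symmetric e.
Implicit Types (x y u : T -> R) (F U W : {set T}) (v : T).
Local Notation nb := (nb e).
Local Notation clnb := (clnb e).
Local Notation qform := (qform e).

(** Weighted arithmetic-geometric mean on each edge: 2 x_v x_w <= x_v^2 g_w / g_v + x_w^2 g_v / g_w.
    After summation the coefficient of x_v^2 is the sum of g over the neighbours of v divided by
    g_v, which is at most 2 on [W]. *)
Lemma supersolution_psd W (g : T -> R) : (forall v, 0 < g v) ->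
  (forall v, v \in W -> \sum_(w in nb v) g w <= 2 * g v) -> psd_on R e W.
Proof.
move=> g0 gW x xW; rewrite /qform /bform subr_ge0.
pose h v w := x v ^+ 2 * (g w / g v).
have hE : \sum_v \sum_(w | e v w) x v * x w <=
    \sum_v \sum_(w | e v w) (h v w + h w v) / 2.
  apply: ler_sum => v _; apply: ler_sum => w _; rewrite /h.
  have gv := g0 v; have gw := g0 w.
  have -> : x v ^+ 2 * (g w / g v) + x w ^+ 2 * (g v / g w) =
     (x v * g w - x w * g v) ^+ 2 / (g v * g w) + 2 * (x v * x w).
    by field; rewrite !gt_eqF.
  have := sqr_ge0 (x v * g w - x w * g v).
  have : 0 < (g v * g w)^-1 by rewrite invr_gt0 mulr_gt0.
  by move=> ha hb; have := mulr_ge0 hb (ltW ha); lra.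
apply: le_trans hE _.
have -> : \sum_v \sum_(w | e v w) (h v w + h w v) / 2 = \sum_v \sum_(w | e v w)
  h v w.
  have sw : \sum_v \sum_(w | e v w) h w v = \sum_v \sum_(w | e v w) h v w.
    rewrite (exchange_big_dep predT) //=; apply: eq_bigr => v _.
    by apply: eq_bigl => w; rewrite e_sym.
  transitivity (\sum_v ((\sum_(w | e v w) h v w + \sum_(w | e v w) h w v) / 2)).
    by apply: eq_bigr => v _; rewrite -big_split /= mulr_suml.
  rewrite -mulr_suml big_split /= sw; by field.
rewrite mulr_sumr; apply: ler_sum => v _; rewrite /h -mulr_sumr -mulr_suml.
have [vW|/xW ->] := boolP (v \in W); last by rewrite expr0n /= !mul0r mulr0.
have -> : \sum_(w | e v w) g w = \sum_(w in nb v) g w.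
  by apply: eq_bigl => w; rewrite inE.
have : (\sum_(w in nb v) g w) / g v <= 2 by rewrite ler_pdivrMr // gW.
have := sqr_ge0 (x v); set s := _ / _; nra.
Qed.

(* Equivalently, the induced graph has an adjacency eigenvalue at least 2. *)
Definition heavy F := exists u : T -> R,
  [/\ forall v, 0 <= u v, supported F u, 0 < \sum_v u v & qform u <= 0].

Lemma subsolution_qform u : (forall v, 0 <= u v) ->
  (forall v, 2 * u v <= \sum_(w in nb v) u w) -> qform u <= 0.
Proof.
move=> u0 hu; rewrite /qform /bform subr_le0 mulr_sumr.
apply: ler_sum => v _; rewrite -mulr_sumr mulrCA ler_wpM2l //.
apply: le_trans (hu v) _; rewrite le_eqVlt; apply/orP; left; apply/eqP.
by apply: eq_bigl => w; rewrite inE.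
Qed.

Section Immersion.
Variables (k : nat) (phi : 'I_k -> T) (t : rel 'I_k) (f : 'I_k -> nat).
Hypotheses (t_sym : symmetric t) (f_gt0 : forall i, (0 < f i)%N).
Hypothesis phi_hom : forall i j, t i j -> e (phi i) (phi j).
Hypothesis phi_inj : forall i j l, t i j -> t i l -> phi j = phi l -> j = l.

(* [f] is pushed forward along a locally injective homomorphism, which need not
   be injective: paths in the source may close up in the graph. *)
Let u v : R := \sum_(i | phi i == v) (f i)%:R.

(** Each [j] is counted at most once on the left: local injectivity at [j] leaves at most one
    neighbour [i] of [j] over [v], and then [v] is adjacent to [phi j]. *)
Lemma immersion_sum v :
  \sum_(i | phi i == v) \sum_(j | t i j) (f j)%:R <= \sum_(w in nb v) u w.
Proof.
have -> : \sum_(w in nb v) u w = \sum_(j | e v (phi j)) (f j)%:R.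
  rewrite /u (exchange_big_dep predT) //= [RHS]big_mkcond;
    apply: eq_bigr => j _.
  rewrite (eq_bigl (fun w => (w == phi j) && e v w)); last first.
    by move=> w; rewrite inE andbC eq_sym.
  by rewrite big_mkcondr big_pred1_eq.
rewrite (exchange_big_dep predT) //= [leRHS]big_mkcond; apply: ler_sum => j _.
case: (pickP (fun i => (phi i == v) && t i j)) => [i /andP[/eqP iv tij]|no].
  rewrite -{2}iv phi_hom // (big_pred1 i) // => l;
    apply/andP/eqP => [[/eqP lv tlj]|->].
    by apply: (@phi_inj j); rewrite ?lv // t_sym.
  by rewrite iv.
by rewrite big_pred0 //; case: ifP => // _; rewrite ler0n.
Qed.

Lemma immersion_subsolution : (forall i, 2 * f i <= \sum_(j | t i j) f j)%N ->
  forall v, 2 * u v <= \sum_(w in nb v) u w.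
Proof.
move=> hf v; apply: le_trans (immersion_sum v); rewrite mulr_sumr.
by apply: ler_sum => i _; rewrite -natrM -natr_sum ler_nat.
Qed.

Lemma immersion_heavy : (0 < k)%N -> (forall i, 2 * f i <= \sum_(j | t i j) f
  j)%N ->
  heavy [set phi i | i in 'I_k].
Proof.
move=> k0 hf; exists u; have u0 v : 0 <= u v by apply: sumr_ge0 => i _;
  apply: ler0n.
split=> // [v vF|| ].
- rewrite /u big_pred0 // => i; apply/eqP => iv.
  by case/negP: vF; apply/imsetP; exists i.
- rewrite (bigD1 (phi (Ordinal k0))) //= ltr_wpDr ?sumr_ge0 //.
  by rewrite /u (bigD1 (Ordinal k0)) //= ltr_wpDr ?sumr_ge0 // ltr0n.
exact: subsolution_qform (immersion_subsolution hf).
Qed.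

End Immersion.

Lemma uniq_map_inj (T1 T2 : eqType) (h : T1 -> T2) (s : seq T1) :
  uniq (map h s) -> {in s &, injective h}.
Proof.
elim: s => // a s IH /= /andP[ha us] x y; rewrite !inE.
case/orP=> [/eqP->|xs] /orP[/eqP->|ys] // hxy; last exact: IH.
- by case/negP: ha; rewrite hxy map_f.
- by case/negP: ha; rewrite -hxy map_f.
Qed.

(* The source graph of an immersion, with edges [E] between positions in the
  list
   [s] of image vertices; the weights [f] used below are the null vectors of the
   affine Dynkin diagrams. *)
Definition edge_nbs (E : seq (nat * nat)) i : seq nat :=
  [seq p.2 | p <- E & p.1 == i] ++ [seq p.1 | p <- E & p.2 == i].

(** A boolean, so that for a concrete diagram it reduces by computation to known edges and
    inequalities between vertices. *)
Definition immersed (x0 : T) (s : seq T) (E : seq (nat * nat)) (f : seq nat) :=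
  [&& all (fun p => [&& e (nth x0 s p.1) (nth x0 s p.2), p.1 < size s & p.2 <
    size s]%N) E,
      all (fun i => [&& uniq [seq nth x0 s j | j <- edge_nbs E i],
                       (0 < nth 0 f i)%N &
                       (2 * nth 0 f i <= sumn [seq nth 0 f j | j <- edge_nbs E
                         i])%N])
          (iota 0 (size s)) &
      (0 < size s)%N].

Lemma mem_edge_nbs E i j :
  (j \in edge_nbs E i) = ((i, j) \in E) || ((j, i) \in E).
Proof.
rewrite mem_cat; congr (_ || _).
  apply/mapP/idP => [[[a b]] |ij]; last by exists (i, j);
    rewrite ?mem_filter ?eqxx.
  by rewrite mem_filter => /andP[/eqP /= <-] + -> /=.
apply/mapP/idP => [[[a b]] |ij]; last by exists (j, i);
  rewrite ?mem_filter ?eqxx.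
by rewrite mem_filter => /andP[/eqP /= <-] + -> /=.
Qed.

Lemma immersed_heavy (x0 : T) s E f : immersed x0 s E f -> heavy [set v in s].
Proof.
case/and3P=> /allP hE /allP hi s0.
pose phi (i : 'I_(size s)) := nth x0 s i.
pose t : rel 'I_(size s) := fun i j => (val j \in edge_nbs E i).
have iP (i : 'I_(size s)) : val i \in iota 0 (size s) by rewrite mem_iota /=
  add0n.
have t_sym : symmetric t by move=> i j; rewrite /t !mem_edge_nbs orbC.
have uq (i : 'I_(size s)) : uniq (edge_nbs E i).
  by case/and3P: (hi _ (iP i)) => /map_uniq.
have lt_nb i j : j \in edge_nbs E i -> (j < size s)%N.
  by rewrite mem_edge_nbs => /orP[]/hE/and3P[].
suff : heavy [set phi i | i in 'I_(size s)].
  congr heavy; apply/setP => v; rewrite inE; apply/imsetP/idP => [[i _ ->]|].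
    by rewrite mem_nth.
  by move=> vs; exists (Ordinal (etrans (index_mem v s) vs));
    rewrite // /phi nth_index.
apply: (immersion_heavy (t := t) (f := fun i => nth 0 f i)) => //.
- by move=> i; case/and3P: (hi _ (iP i)).
- move=> i j; rewrite /t mem_edge_nbs => /orP[]/hE/and3P[] //; by rewrite e_sym.
- move=> i j l tij til jl; apply: val_inj.
  have /and3P[u_i _ _] := hi _ (iP i).
  exact: (uniq_map_inj u_i tij til jl).
- move=> i; have /and3P[_ _] := hi _ (iP i);
  rewrite sumnE big_map => /leq_trans; apply.
  have pe : perm_eq (edge_nbs E i) [seq j <- iota 0 (size s) | j \in edge_nbs E
    i].
    apply: uniq_perm; rewrite ?filter_uniq ?iota_uniq // => j.
    rewrite mem_filter mem_iota /= add0n;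
      case: (boolP (j \in _)) => // /lt_nb ->.
    by [].
  have io : iota 0 (size s) = index_iota 0 (size s) by rewrite /index_iota
    subn0.
  by rewrite (perm_big _ pe) big_filter io big_mkord.
Qed.

End Certificates.

(** * Graphs of maximum degree three without small heavy sets *)

Section Subcubic.
Variables (R : realFieldType) (T : finType) (e : rel T).
Hypothesis e_sym : symmetric e.
Local Notation nb := (nb e).
Local Notation clnb := (clnb e).
Hypothesis deg3 : forall v, (#|nb v| <= 3)%N.
Hypothesis light : forall F, (#|clnb F| <= 29)%N -> ~ heavy R e F.

Let en x y : e x y = (y \in nb x).
Proof. by rewrite inE. Qed.

(** Each vertex of [F] spends one of its at most three adjacencies inside [F], so it accounts for
    itself and at most two vertices outside. *)
Lemma card_clnb_subcubic (F : {set T}) :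
  (forall v, v \in F -> exists2 w, w \in F & e v w) -> (#|clnb F| <= 3 *
    #|F|)%N.
Proof.
move=> hF.
have sub : clnb F \subset \bigcup_(v in F) (v |: (nb v :\: F)).
  apply/subsetP => w; rewrite !inE => /orP[wF|/bigcupP[v vF vw]].
    by apply/bigcupP; exists w; rewrite ?inE ?eqxx.
  have [wF|wF] := boolP (w \in F); first by apply/bigcupP; exists w;
    rewrite ?inE ?eqxx.
  by apply/bigcupP; exists v => //; rewrite in_setU in_setD wF vw orbT.
apply: leq_trans (subset_leq_card sub) _; rewrite mulnC -sum_nat_const.
elim/big_rec2: _ => [|v A k vF IH]; first by rewrite cards0.
apply: leq_trans (leq_card_setU _ _) _; apply: leq_add IH.
apply: leq_trans (leq_card_setU _ _) _; rewrite cards1 ltnS.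
have [w wF vw] := hF v vF.
have := deg3 v; rewrite (cardsD1 w) inE vw ltnS; apply: leq_trans.
apply/subset_leq_card/subsetP => z; rewrite !inE => /andP[zF ->].
by rewrite andbT; apply: contraNneq zF => ->.
Qed.

(** Nine is the order of affine E8, the largest diagram used, and 3 * 9 = 27 <= 29. Positive weights
    force every position to have a neighbour, as [card_clnb_subcubic] requires. *)
Lemma no_immersed (x0 : T) s E f : (size s <= 9)%N -> ~ immersed e x0 s E f.
Proof.
move=> s9 im; apply: (@light [set v in s]); last exact: immersed_heavy im.
have cs : (#|[set v in s]| <= size s)%N by rewrite cardsE card_size.
apply: leq_trans (card_clnb_subcubic _) _; last by lia.
move=> v; rewrite inE => vs; case/and3P: im => /allP hE /allP hi _.
have := hi (index v s);
  rewrite mem_iota /= add0n index_mem => /(_ vs) /and3P[_ f0 fs].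
case def : (edge_nbs E (index v s)) => [|j l]; first by move: fs;
  rewrite def /=; lia.
have : j \in edge_nbs E (index v s) by rewrite def mem_head.
rewrite mem_edge_nbs => /orP[]/hE/and3P[]; rewrite /= nth_index // => vj h1 h2.
  by exists (nth x0 s j); rewrite // inE mem_nth.
by exists (nth x0 s j); rewrite 1?e_sym // inE mem_nth.
Qed.

Lemma nb_cases v w : e v w ->
  [\/ nb v = [set w], exists2 z, e v z & z != w /\ nb v = [set w; z] |
      exists z t, [/\ e v z, e v t & [&& z != w, t != w & z != t]]].
Proof.
move=> vw; have cv := deg3 v.
have [/cards1P[z nv]|c1] := boolP (#|nb v| == 1%N).
  by constructor 1; move: vw; rewrite en nv inE => /eqP->.
have [/cards2P[a [b [ab nv]]]|c2] := boolP (#|nb v| == 2%N).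
  have [va vb] : e v a /\ e v b.
    by rewrite !en nv !inE !eqxx ?orbT.
  have : w \in nb v by rewrite inE.
  rewrite nv !inE => /orP[]/eqP->; constructor 2.
    by exists b; rewrite 1?eq_sym.
  by exists a => //; rewrite setUC.
have nw : w \in nb v by rewrite inE.
have c : (1 < #|nb v :\ w|)%N.
  have : (0 < #|nb v|)%N by apply/card_gt0P; exists w.
  by move: c1 c2; rewrite [X in _ -> _ -> (0 < X)%N -> _](cardsD1 w) nw;
    move: cv; rewrite (cardsD1 w) nw; lia.
constructor 3; case/card_gt1P: c => z [t [zn tn zt]].
by move: zn tn; rewrite !in_setD1 -!en => /andP[zw vz] /andP[tw vt];
  exists z, t; rewrite zw tw zt.
Qed.

Definition nb_closed (F : {set T}) := forall v w, v \in F -> e v w -> w \in F.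

(** A closed set is its own closed neighbourhood, so the bound 29 is the one under which [light]
    applies. *)
Definition small_closed v :=
  exists F : {set T}, [/\ v \in F, (#|F| <= 29)%N & nb_closed F].

Lemma small_closed_seq (s : seq T) v : v \in s -> (size s <= 29)%N ->
  (forall x, x \in s -> {subset nb x <= s}) -> small_closed v.
Proof.
move=> vs s29 hs; exists [set x in s]; split; first by rewrite inE.
  by rewrite cardsE (leq_trans (card_size _)).
by move=> x w; rewrite !inE => xs xw; apply: (hs x); rewrite ?inE.
Qed.

(** The legs of lengths 1 and 2 at [v] are complete; the third is followed outwards. If it ends
    within four steps, a closed set of at most eight vertices results (E6, E7 or E8); otherwise it
    branches or becomes too long, and an affine D or E8 immerses. *)
Lemma small_closed_leg v a b c c' b' :
  nb v = [set a; b; c] -> uniq [:: a; b; c] -> nb a = [set v] ->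
  nb b = [set v; b'] -> nb c = [set v; c'] -> nb c' = [set c] ->
  b' != v -> c' != v -> small_closed v.
Proof.
move=> nv uv na nb_b nc nc' b'v c'v.
have [va vb vc] : [/\ e v a, e v b & e v c] by rewrite !en nv !inE !eqxx ?orbT.
have bb' : e b b' by rewrite en nb_b !inE eqxx orbT.
have cc' : e c c' by rewrite en nc !inE eqxx orbT.
move: uv; rewrite /= !inE negb_or !andbT => /andP[/andP[ab ac] bc].
have b'b : e b' b by rewrite e_sym.
case: (nb_cases b'b) => [nb'|[b2 b'b2 [b2b nb']]|[x [y [b'x b'y /and3P[xb yb
  xy]]]]].
- apply: (@small_closed_seq [:: v; a; b; c; b'; c']); rewrite ?inE ?eqxx //.
  move=> x; rewrite !inE => xs y; rewrite !inE en.
  by case/or4P: xs => [||| /or3P[]] /eqP->;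
    rewrite ?nv ?na ?nb_b ?nc ?nb' ?nc' !inE => yy;
    repeat (case/orP: yy => yy); rewrite yy ?orbT.
- have b2b' : e b2 b' by rewrite e_sym.
  case: (nb_cases b2b') => [nb2|[b3 b2b3 [b3b' nb2]]|[x [y [b2x b2y /and3P[xb'
    yb' xy]]]]].
  + apply: (@small_closed_seq [:: v; a; b; c; b'; c'; b2]);
    rewrite ?inE ?eqxx //.
    move=> x; rewrite !inE => xs y; rewrite !inE en.
    by case/or4P: xs => [||| /or4P[]] /eqP->;
      rewrite ?nv ?na ?nb_b ?nc ?nb' ?nc' ?nb2 !inE => yy;
      repeat (case/orP: yy => yy); rewrite yy ?orbT.
  + have b3b2 : e b3 b2 by rewrite e_sym.
    have [nb3|[b4 [b3b4 b4b2]]] : nb b3 = [set b2] \/ exists b4, e b3 b4 /\ b4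
      != b2.
      case: (nb_cases b3b2) => [->|[b4 h [h' _]]|[b4 [_ [h _ /andP[h' _]]]]];
        first by left.
        by right; exists b4.
      by right; exists b4.
    * apply: (@small_closed_seq [:: v; a; b; c; b'; c'; b2; b3]);
      rewrite ?inE ?eqxx //.
      move=> x; rewrite !inE => xs y; rewrite !inE en.
      by case/or4P: xs => [||| /or4P[||| /orP[]]] /eqP->;
        rewrite ?nv ?na ?nb_b ?nc ?nb' ?nc' ?nb2 ?nb3 !inE => yy;
        repeat (case/orP: yy => yy); rewrite yy ?orbT.
    (* Legs of lengths 1, 2 and 5, weighted by the null vector of affine E8. *)
    * exfalso; apply: (@no_immersed v [:: v; a; c; c'; b; b'; b2; b3; b4]
       [:: (0,1); (0,2); (2,3); (0,4); (4,5); (5,6); (6,7); (7,8)]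
       [:: 6; 3; 4; 2; 5; 4; 3; 2; 1])%N => //.
      rewrite /immersed /= !inE !negb_or va vc cc' vb bb' b'b2 b2b3 b3b4 ac ab
        c'v b'v b2b b3b' b4b2.
      by rewrite eq_sym bc.
  (* Two branch vertices joined by a path: affine D7 here, affine D6 in the last case. *)
  + exfalso; apply: (@no_immersed v [:: v; b; b'; b2; a; c; x; y]
       [:: (0,1); (1,2); (2,3); (0,4); (0,5); (3,6); (3,7)]
       [:: 2; 2; 2; 2; 1; 1; 1; 1])%N => //.
    by rewrite /immersed /= !inE !negb_or va vc vb bb' b'b2 b2x b2y ac (eq_sym
      b a) ab bc b'v b2b xb' yb' xy.
- exfalso; apply: (@no_immersed v [:: v; b; b'; a; c; x; y]
     [:: (0,1); (1,2); (0,3); (0,4); (2,5); (2,6)]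
     [:: 2; 2; 2; 1; 1; 1; 1])%N => //.
  by rewrite /immersed /= !inE !negb_or va vc vb bb' b'x b'y ac (eq_sym b a) ab
    bc b'v xb yb xy.
Qed.

Lemma leaf_or v w : e v w -> nb v = [set w] \/ exists2 z, e v z & z != w.
Proof.
case/nb_cases => [->|[z h [h' _]]|[z [_ [h _ /andP[h' _]]]]]; first by left.
  by right; exists z.
by right; exists z.
Qed.

(** A second branch at [b] or [c] gives affine D5, three legs of length at least 2 give affine E6,
    and legs of lengths at least 1, 3, 3 give affine E7. Otherwise [a] is a leaf and one of the
    other legs has length 2, which is the case of [small_closed_leg]. *)
Lemma small_closed_branch v a b c : nb v = [set a; b; c] -> uniq [:: a; b; c] ->
  nb b != [set v] -> nb c != [set v] -> small_closed v.
Proof.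
move=> nv uv lb lc.
have [va vb vc] : [/\ e v a, e v b & e v c] by rewrite !en nv !inE !eqxx ?orbT.
have uv' := uv; move: uv';
  rewrite /= !inE negb_or !andbT => /andP[/andP[ab ac] bc].
have [av bv cv] : [/\ e a v, e b v & e c v] by rewrite !(e_sym _ v).
case: (nb_cases bv) => [nb_b|[b' bb' [b'v nb_b]]|[x [y [bx by_ /and3P[xv yv
  xy]]]]].
- by rewrite nb_b eqxx in lb.
- case: (nb_cases cv) => [nc|[c' cc' [c'v nc]]|[x [y [cx cy /and3P[xv yv
  xy]]]]].
  + by rewrite nc eqxx in lc.
  + case: (leaf_or av) => [na|[a' aa' a'v]]; last first.
      exfalso; apply: (@no_immersed v [:: v; a; a'; b; b'; c; c']
       [:: (0,1); (1,2); (0,3); (3,4); (0,5); (5,6)]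
       [:: 3; 2; 1; 2; 1; 2; 1])%N => //.
      by rewrite /immersed /= !inE !negb_or va vb vc aa' bb' cc' ab ac bc a'v
        b'v c'v.
    have c'c : e c' c by rewrite e_sym.
    have b'b : e b' b by rewrite e_sym.
    case: (leaf_or c'c) => [nc'|[c2 c'c2 c2c]];
      first exact: (small_closed_leg nv uv na nb_b nc nc' b'v c'v).
    case: (leaf_or b'b) => [nb'|[b2 b'b2 b2b]].
      apply: (small_closed_leg (a := a) (b := c) (c := b) _ _ na nc nb_b nb')
        => //.
        by rewrite nv; apply/setP => z; rewrite !inE orbAC.
      by rewrite /= !inE negb_or ab ac eq_sym bc.
    exfalso; apply: (@no_immersed v [:: v; a; b; b'; b2; c; c'; c2]
       [:: (0,1); (0,2); (2,3); (3,4); (0,5); (5,6); (6,7)]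
       [:: 4; 2; 3; 2; 1; 3; 2; 1])%N => //.
    by rewrite /immersed /= !inE !negb_or va vb vc bb' cc' b'b2 c'c2 ab ac bc
      b'v c'v b2b c2c.
  + exfalso; apply: (@no_immersed v [:: v; c; a; b; x; y]
       [:: (0,1); (0,2); (0,3); (1,4); (1,5)] [:: 2; 2; 1; 1; 1; 1])%N => //.
    by rewrite /immersed /= !inE !negb_or va vb vc cx cy (eq_sym c a) (eq_sym c
      b) ab ac bc xv yv xy.
- exfalso; apply: (@no_immersed v [:: v; b; a; c; x; y]
       [:: (0,1); (0,2); (0,3); (1,4); (1,5)] [:: 2; 2; 1; 1; 1; 1])%N => //.
  by rewrite /immersed /= !inE !negb_or va vb vc bx by_ (eq_sym b a) ab ac bc
    xv yv xy.
Qed.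

Definition two_leaves v := exists a b c,
  [/\ nb v = [set a; b; c], uniq [:: a; b; c], nb a = [set v] & nb b = [set v]].

(** If at most one neighbour is a leaf, two are not and [small_closed_branch] applies; the rest
    permutes the three neighbours. *)
Lemma branch_cases v : #|nb v| = 3%N -> two_leaves v \/ small_closed v.
Proof.
move=> c3.
have /card_gt0P[a va] : (0 < #|nb v|)%N by rewrite c3.
have /card_gt1P[b [c [vb vc bc]]] : (1 < #|nb v :\ a|)%N.
  by move: c3; rewrite (cardsD1 a) va; lia.
move: vb vc; rewrite !in_setD1 => /andP[ba vb] /andP[ca vc].
have nv : nb v = [set a; b; c].
  apply/esym/eqP; rewrite eqEcard c3; apply/andP; split.
    by apply/subsetP => z; rewrite !inE -!orbA => /or3P[]/eqP->;
      [move: va|move: vb|move: vc]; rewrite inE.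
  by rewrite -setUA cardsU1 !inE negb_or (eq_sym a b) (eq_sym a c) ba ca cards2
    bc.
have u3 : uniq [:: a; b;
  c] by rewrite /= !inE negb_or (eq_sym a b) (eq_sym a c) ba ca bc.
have [na|na] := eqVneq (nb a) [set v].
  have [nb_b|nb_b] := eqVneq (nb b) [set v]; first by left; exists a, b, c.
  have [nc|nc] := eqVneq (nb c) [set v]; last by right;
    apply: (small_closed_branch nv).
  left; exists a, c, b; split => //; first by rewrite nv; apply/setP => z;
    rewrite !inE orbAC.
  by move: u3; rewrite /= !inE !negb_or (eq_sym b c) => /and3P[/andP[-> ->] ->].
have [nb_b|nb_b] := eqVneq (nb b) [set v]; last first.
  right; apply: (@small_closed_branch v c a b) => //.
    by rewrite nv; apply/setP => z; rewrite !inE; case: (z == a);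
      case: (z == b); case: (z == c).
  by rewrite /= !inE negb_or ca (eq_sym c b) bc (eq_sym a b) ba.
have [nc|nc] := eqVneq (nb c) [set v]; last first.
  right; apply: (@small_closed_branch v b a c) => //.
    by rewrite nv; apply/setP => z; rewrite !inE; case: (z == a);
      case: (z == b); case: (z == c).
  by rewrite /= !inE negb_or ba bc (eq_sym a c) ca.
left; exists b, c, a; split => //.
  by rewrite nv; apply/setP => z; rewrite !inE; case: (z == a);
    case: (z == b); case: (z == c).
by rewrite /= !inE negb_or ba ca bc.
Qed.

Lemma light_psd F : (#|clnb F| <= 29)%N -> psd_on R e F.
Proof.
move=> cF x xF; rewrite leNgt; apply/negP => qx; apply: (light cF).
exists (fun v => `|x v|); split => //; first exact: supported_abs.
  rewrite lt_def sumr_ge0 // andbT; apply: contraTneq qx => s0.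
  have x0 v : x v = 0.
    move/eqP: s0; rewrite psumr_eq0 // => /allP/(_ v).
    by rewrite mem_index_enum normr_eq0 => /(_ isT)/eqP.
  by rewrite /qform /bform !big1 ?mulr0 ?subr0 ?ltxx // => v _;
    rewrite ?x0 ?mul0r // big1 // => w _; rewrite mul0r.
exact: le_trans (qform_abs _ _) (ltW qx).
Qed.

(** Small closed sets are split off by induction on [#|W|]: no edge leaves them, so the form is a
    sum of two, one light and one on a smaller closed set. Once none is left, a supersolution is
    exhibited. *)
Lemma subcubic_psd (W : {set T}) : nb_closed W -> psd_on R e W.
Proof.
have [m] := ubnP #|W|; elim: m W => // m IH W; rewrite ltnS => cW clW.
have [[v vW [F0 [vF0 cF0 clF0]]]|no] :
  (exists2 v, v \in W & small_closed v) \/ (forall v, v \in W -> ~ small_closed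
    v).
- pose P v := (v \in W) && [exists F : {set T}, [&& v \in F, #|F| <= 29 &
     [forall x in F, forall y, e x y ==> (y \in F)]]]%N.
  have PE v : P v <-> v \in W /\ small_closed v.
    split=> [/andP[vW /existsP[F /and3P[vF cF /forall_inP cl]]]|[vW [F [vF cF
      cl]]]].
      by split=> //; exists F; split=> // x y xF;
        move/forallP/(_ y)/implyP: (cl x xF); apply.
    rewrite /P vW; apply/existsP; exists F; rewrite vF cF /=.
    by apply/forall_inP => x xF; apply/forallP => y; apply/implyP; apply: cl.
  case: (pickP P) => [v /PE[vW sv]|no]; first by left; exists v.
  by right=> v vW sv; have := no v; rewrite (proj2 (PE v)).
- have clI : nb_closed (W :&: F0).
    by move=> x y; rewrite !inE => /andP[xW xF] xy; rewrite (clW x) // (clF0 x).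
  have clD : nb_closed (W :\: F0).
    move=> x y; rewrite !inE => /andP[xF xW] xy; rewrite (clW x) // andbT.
    by apply: contra xF => yF; apply: (clF0 y); rewrite // e_sym.
  have cl1 : clnb (W :&: F0) = W :&: F0.
    apply/setP => y; rewrite in_setU; case: (boolP (y \in W :&: F0)) => //= yI.
    by apply/negP => /bigcupP[x xI]; rewrite -en => /(clI _ _ xI); apply/negP.
  have psdI : psd_on R e (W :&: F0).
    apply: light_psd; rewrite cl1; apply: leq_trans cF0.
    exact/subset_leq_card/subsetIr.
  have psdD : psd_on R e (W :\: F0).
    apply: IH clD; apply: leq_trans cW; apply: proper_card; apply/properP;
      split.
      exact: subsetDl.
    by exists v; rewrite // inE vF0.
  move=> x xW; pose x1 v := if v \in F0 then x v else 0;
    pose x2 v := if v \in F0 then 0 else x v.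
  have x1I : supported (W :&: F0) x1.
    by move=> z; rewrite /x1 inE; case: ifP => //= _; rewrite andbT => /xW.
  have x2D : supported (W :\: F0) x2.
    by move=> z; rewrite /x2 inE; case: ifP => //= _ /xW.
  have -> : qform e x = qform e (fun z => x1 z + 1 * x2 z).
    by apply: eq_qform => z; rewrite /x1 /x2 mul1r; case: ifP;
      rewrite ?addr0 ?add0r.
  rewrite qform_comb // (bform_disjoint x1I).
    by rewrite mulr0 addr0 expr1n mul1r; apply: addr_ge0;
      [apply: psdI|apply: psdD].
  by move=> z; rewrite inE negbK cl1 inE => /andP[_ zF]; rewrite /x2 zF.
(* Every vertex of degree 3 in [W] has two pendant neighbours, so that the
   null vector of the affine graphs of type D is a supersolution. *)
pose g v : R := if #|nb v| == 1%N then 1 else 2.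
have g2 v : g v <= 2 by rewrite /g; case: ifP => // _; lra.
have g1 v : g v = 1 \/ g v = 2 by rewrite /g; case: ifP; [left|right].
apply: (@supersolution_psd _ _ _ e_sym _ g) => [v|v vW];
  first by case: (g1 v) => ->; lra.
have bound : \sum_(w in nb v) g w <= \sum_(w in nb v) 2.
  by apply: ler_sum.
(* Away from degree 3 the bound [g <= 2] on the neighbours suffices: the sum is at most 2 = 2 g v at
   a leaf and at most 4 = 2 g v otherwise. *)
have [c3|c3] := eqVneq #|nb v| 3%N; last first.
  apply: le_trans bound _; rewrite sumr_const -mulr_natr.
  rewrite /g; case: eqVneq => [->|c1]; first by lra.
  have : (#|nb v| <= 2)%N by have := deg3 v; lia.
  by rewrite -(ler_nat R); lra.
case: (branch_cases c3) => [[a [b [c [nv u3 na nb_b]]]]|/(no v vW) //].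
have gv : g v = 2 by rewrite /g c3.
have -> : nb v = a |: (b |: [set c]) by rewrite nv setUA.
move: u3; rewrite /= !inE negb_or !andbT => /andP[/andP[ab ac] bc].
rewrite !big_setU1 ?inE ?negb_or ?ab //= big_set1.
have -> : g a = 1 by rewrite /g na cards1.
have -> : g b = 1 by rewrite /g nb_b cards1.
by rewrite gv; have := g2 c; lra.
Qed.
End Subcubic.

(** * Graphs with a large independent set: degree bounds and the final case analysis *)

Lemma subset_of_card (T : finType) (X : {set T}) k : (k <= #|X|)%N ->
  exists2 Z : {set T}, Z \subset X & #|Z| = k.
Proof.
move=> kX; exists [set z in take k (enum X)].
  by apply/subsetP => z; rewrite inE => /mem_take; rewrite mem_enum.
rewrite cardsE; move/card_uniqP: (take_uniq k (enum_uniq X)) => ->.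
by rewrite size_take -cardE; case: ltngtP kX.
Qed.

Section LargeIndependentSet.
Variables (R : realFieldType) (T : finType) (e : rel T).
Hypotheses (e_sym : symmetric e) (e_irr : irreflexive e).
Local Notation nb := (nb e).
Local Notation clnb := (clnb e).
Local Notation qform := (@qform R T e).
Local Notation bform := (@bform R T e).
Hypothesis psdP : forall x, 0 <= pform e x :> R.

Variable A : {set T}.
Hypothesis A_indep : forall v w, v \in A -> w \in A -> ~~ e v w.

Definition degA v := #|nb v :&: A|.
(** The value at the indicator of [Z] of the linear form whose square appears in [schur_ineq]. *)
Definition weight (Z : {set T}) := (\sum_(z in Z) (degA z + 2))%N.

Lemma double_count (Z B : {set T}) :
  (\sum_(z in Z) #|nb z :&: B| = \sum_(p in B) #|nb p :&: Z|)%N.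
Proof.
transitivity (\sum_(z in Z) \sum_(p in B) (e z p))%N.
  apply: eq_bigr => z _; rewrite -sum1_card big_mkcond [RHS]big_mkcond.
  by apply: eq_bigr => p _; rewrite !inE andbC; case: (p \in B); case: (e z p).
rewrite exchange_big; apply: eq_bigr => p _.
rewrite -sum1_card big_mkcond [RHS]big_mkcond.
by apply: eq_bigr => z _; rewrite !inE e_sym andbC; case: (z \in Z);
  case: (e p z).
Qed.

(* Eliminating the coordinates in [A], i.e. taking the Schur complement of the
   block [J + 4I]: the optimal coordinates on [A] are those of [chi]. *)
Lemma schur_ineq (xi : T -> R) : supported (~: A) xi ->
  0 <= 2 * qform xi - \sum_(p in A) (\sum_(z in nb p) xi z) ^+ 2
     + (\sum_v (degA v + 2)%:R * xi v) ^+ 2 / (#|A| + 4)%:R.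
Proof.
move=> xiA; pose N p := \sum_(z in nb p) xi z.
pose s := \sum_v xi v; pose D := \sum_(p in A) N p;
  pose E := \sum_(p in A) N p ^+ 2.
have WE : \sum_v (degA v + 2)%:R * xi v = D + 2 * s.
  transitivity (\sum_v (\sum_(p in A) (if e p v then xi v else 0) + 2 * xi v)).
    apply: eq_bigr => v _; rewrite natrD mulrDl; congr (_ + _).
    rewrite -big_mkcondr sumr_const mulr_natl; congr (_ *+ _).
    by apply: eq_card => p; rewrite !inE e_sym andbC.
  rewrite big_split -mulr_sumr exchange_big /=; congr (_ + _).
  apply: eq_bigr => p _; rewrite -big_mkcond; apply: eq_bigl => v.
  by rewrite inE.
rewrite WE; set W := D + _; set a := #|A|.
(* Stationarity at [p] in [A] reads chi p = N p / 2 - t / 4, where t is the sum of all coordinates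
   of xi + chi; solving for t gives t / 4 = [c]. *)
pose c := W / (2 * (a + 4)%:R).
pose chi v := if v \in A then N v / 2 - c else 0.
have a4 : (a + 4)%:R != 0 :> R by rewrite pnatr_eq0 addnC.
have sum_chi : \sum_v chi v = D / 2 - a%:R * c.
  rewrite -big_mkcond sumrB -mulr_suml sumr_const mulr_natl; congr (_ - _ *+ _).
have cross : bform chi xi = - (E / 2 - c * D).
  rewrite /bform big1 ?mulr0 ?sub0r => [|v _]; last first.
    by rewrite /chi; case: ifP => vA; rewrite ?mul0r // xiA ?mulr0 // inE vA.
  congr (- _);
    transitivity (\sum_v (if v \in A then (N v / 2 - c) * N v else 0)).
    apply: eq_bigr => v _; rewrite -mulr_sumr /chi; case: ifP => _;
      rewrite ?mul0r //.
    by congr (_ * _); apply: eq_bigl => w; rewrite inE.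
  rewrite -big_mkcond mulr_suml mulr_sumr -sumrB; apply: eq_bigr => p _;
    by field.
have q_chi : qform chi = 2 * (E / 4 - c * D + a%:R * c ^+ 2).
  rewrite /qform /bform [X in _ - X]big1 ?subr0 => [|v _]; last first.
    apply: big1 => w vw; rewrite /chi; case: ifP => vA; rewrite ?mul0r //.
    by case: ifP => wA; rewrite ?mulr0 //; have := A_indep vA wA; rewrite vw.
  congr (_ * _); transitivity (\sum_(p in A) (N p ^+ 2 / 4 - c * N p + c ^+ 2)).
    rewrite [RHS]big_mkcond; apply: eq_bigr => v _; rewrite /chi.
    by case: ifP => _; rewrite ?mul0r //; by field.
  by rewrite !big_split /= sumr_const mulr_natl -mulr_suml sumrN -mulr_sumr.
have := psdP (fun v => xi v + 1 * chi v).
rewrite /pform qform_comb // bformC // cross q_chi big_split -mulr_sumr /=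
  sum_chi -/s.
move=> h; apply: le_trans h _; rewrite le_eqVlt; apply/orP; left; apply/eqP.
rewrite -[\sum_(p in A) _ ^+ 2]/E /c /W; move: a4; rewrite natrD => a4;
  by field.
Qed.

Definition ind (Z : {set T}) v : R := (v \in Z)%:R.

Lemma sum_ind (f : T -> R) Z : \sum_v f v * ind Z v = \sum_(v in Z) f v.
Proof.
rewrite [RHS]big_mkcond; apply: eq_bigr => v _; rewrite /ind.
by case: (v \in Z); rewrite ?mulr1 ?mulr0.
Qed.

Lemma sum_nb_ind Z p : \sum_(z in nb p) ind Z z = #|nb p :&: Z|%:R.
Proof.
rewrite -sum1_card natr_sum [RHS]big_mkcond [LHS]big_mkcond.
by apply: eq_bigr => z _; rewrite /ind in_setI; case: (z \in nb p);
  case: (z \in Z).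
Qed.

Lemma qform_ind Z : qform (ind Z) <= 2 * #|Z|%:R.
Proof.
rewrite /qform /bform sum_ind (eq_bigr (fun=> 1)) => [|z];
  last by rewrite /ind => ->.
rewrite sumr_const gerBl.
by do 2![apply: sumr_ge0 => ? _]; rewrite mulr_ge0 ?ler0n.
Qed.

Lemma weight_ind Z :
  \sum_v (degA v + 2)%:R * ind Z v = (weight Z)%:R.
Proof. by rewrite sum_ind -natr_sum. Qed.

Lemma sum_degA (Z : {set T}) : (\sum_(p in A) #|nb p :&: Z| = weight Z - 2 *
  #|Z|)%N.
Proof.
by rewrite -double_count /weight big_split /= sum_nat_const mulnC addnK.
Qed.

Lemma weight_ge (Z : {set T}) : (2 * #|Z| <= weight Z)%N.
Proof. by rewrite mulnC -sum_nat_const leq_sum // => z _; rewrite leq_addl. Qed.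

(** Edges inside [Z] only lower the form, so [Z] may be counted as if it were independent. *)
Lemma qform_star y (Z : {set T}) (b : R) : Z \subset nb y ->
  qform (fun v => ind Z v + b * (v == y)%:R) <=
  2 * #|Z|%:R - 2 * b * #|Z|%:R + 2 * b ^+ 2.
Proof.
move=> sZ; rewrite qform_comb // bform_delta // qform_delta // sum_nb_ind.
have -> : nb y :&: Z = Z by apply/setIidPr.
have -> : ind Z y = 0.
  by rewrite /ind; case: (boolP (y \in Z)) => // /(subsetP sZ);
    rewrite inE e_irr.
have := qform_ind Z; rewrite -[qform _]/(qform (ind Z)); lra.
Qed.

(** This is [schur_ineq] at the vector with 1 on [Z] and [b] at [y]. With k = [#|nb p :&: Z|], the
    square at [p] is at least k, plus [b ^+ 2] when [p] is a neighbour of [y]: k <= k^2 for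
    naturals, and the cross term is nonnegative. *)
Lemma star_ineq y (Z : {set T}) (b : R) : y \notin A -> Z \subset nb y :\: A ->
  0 <= b ->
  0 <= (4 - (degA y)%:R) * b ^+ 2 + 6 * #|Z|%:R - (weight Z)%:R - 4 * b *
    #|Z|%:R
     + (b * (degA y + 2)%:R + (weight Z)%:R) ^+ 2 / (#|A| + 4)%:R.
Proof.
move=> yA sZ b0; pose xi v := ind Z v + b * (v == y)%:R.
have ZA z : z \in Z -> (z \notin A) * (e y z).
  by move/(subsetP sZ); rewrite !inE => /andP[-> ->].
have xiA : supported (~: A) xi.
  move=> v; rewrite inE negbK => vA; rewrite /xi /ind.
  have -> : (v \in Z) = false by apply/negP => /ZA; rewrite vA; case.
  have -> : (v == y) = false by apply: contraTF vA => /eqP->.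
  by rewrite mulr0 addr0.
have := schur_ineq xiA.
have -> : \sum_v (degA v + 2)%:R * xi v = b * (degA y + 2)%:R + (weight Z)%:R.
  rewrite /xi -weight_ind addrC (eq_bigr (fun v => (degA v + 2)%:R * ind Z v +
     b * ((degA v + 2)%:R * (v == y)%:R))) => [|v _]; last by ring.
  rewrite big_split -mulr_sumr /=; congr (_ + _ * _).
  rewrite (bigD1 y) //= eqxx mulr1 big1 ?addr0 // => v /negPf->.
  by rewrite mulr0.
have qxi : qform xi <= 2 * #|Z|%:R - 2 * b * #|Z|%:R + 2 * b ^+ 2.
  by apply: qform_star; apply: subset_trans sZ (subsetDl _ _).
have sq : (degA y)%:R * b ^+ 2 + (weight Z)%:R - 2 * #|Z|%:R <=
    \sum_(p in A) (\sum_(z in nb p) xi z) ^+ 2.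
  have -> : (degA y)%:R * b ^+ 2 = \sum_(p in A) (e y p)%:R * b ^+ 2.
    rewrite -mulr_suml; congr (_ * _); rewrite -natr_sum; congr _%:R.
    rewrite /degA -sum1_card big_mkcond [RHS]big_mkcond.
    by apply: eq_bigr => p _; rewrite !inE andbC; case: (p \in A);
      case: (e y p).
  have := sum_degA Z; have := weight_ge Z => wge wE.
  have -> : (weight Z)%:R = \sum_(p in A) #|nb p :&: Z|%:R + 2 * #|Z|%:R :> R.
    by rewrite -natr_sum wE -natrM -natrD; congr _%:R; lia.
  rewrite addrA addrK -big_split /=; apply: ler_sum => p pA.
  have -> : \sum_(z in nb p) xi z = #|nb p :&: Z|%:R + b * (e y p)%:R.
    rewrite big_split -mulr_sumr /= sum_nb_ind; congr (_ + _ * _).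
    rewrite big_mkcond (bigD1 y) //= big1 ?addr0 => [|z /negPf->];
      last by case: ifP.
    by rewrite inE e_sym eqxx; case: (e y p).
  have n0 : 0 <= #|nb p :&: Z|%:R :> R by apply: ler0n.
  have nn : #|nb p :&: Z|%:R <= #|nb p :&: Z|%:R ^+ 2 :> R.
    by rewrite -natrX ler_nat; case: #|_| => // k;
      rewrite expnS expn1 leq_pmulr.
  by case: (e y p); rewrite ?mulr1n ?mulr0n; nra.
move: qxi sq; set E := \sum_(p in A) _; set V := _ / _; lra.
Qed.

(** This is [schur_ineq] at the indicator of [Z]: each [p] in [P] contributes the full square of
    [#|Z|], and k <= k^2 is used on the rest of [A]. *)
Lemma common_ineq (P Z : {set T}) : P \subset A -> [disjoint Z & A] ->
  (forall p z, p \in P -> z \in Z -> e p z) ->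
  0 <= 6 * #|Z|%:R - (weight Z)%:R - #|P|%:R * (#|Z|%:R ^+ 2 - #|Z|%:R)
     + (weight Z)%:R ^+ 2 / (#|A| + 4)%:R :> R.
Proof.
move=> PA ZA PZ; have indA : supported (~: A) (ind Z).
  move=> v; rewrite inE negbK /ind => vA; have -> : (v \in Z) = false;
    last by [].
  by apply: contraTF vA => vZ; rewrite (disjointFr ZA).
have := schur_ineq indA; rewrite weight_ind.
have := qform_ind Z.
have : (weight Z)%:R - 2 * #|Z|%:R + #|P|%:R * (#|Z|%:R ^+ 2 - #|Z|%:R) <=
    \sum_(p in A) (\sum_(z in nb p) ind Z z) ^+ 2.
  have wge := weight_ge Z; have wE := sum_degA Z.
  have -> : (weight Z)%:R = \sum_(p in A) #|nb p :&: Z|%:R + 2 * #|Z|%:R :> R.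
    by rewrite -natr_sum wE -natrM -natrD; congr _%:R; lia.
  rewrite addrK (big_setID P) [leRHS](big_setID P) /= (setIidPr PA) addrAC.
  have -> : #|P|%:R * (#|Z|%:R ^+ 2 - #|Z|%:R) = \sum_(p in P) (#|Z|%:R ^+ 2 -
    #|Z|%:R) :> R.
    by rewrite sumr_const mulr_natl.
  rewrite -big_split /=; apply: lerD; apply: ler_sum => p; rewrite sum_nb_ind.
    move=> pP; have -> : nb p :&: Z = Z; last by rewrite addrC subrK.
    by apply/setIidPr/subsetP => z zZ; rewrite inE PZ.
  by move=> _; rewrite -natrX ler_nat; case: #|_| => // k;
    rewrite expnS expn1 leq_pmulr.
set E := \sum_(p in A) _; set V := _ / _; lra.
Qed.


Hypothesis A39 : (39 <= #|A|)%N.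
Hypothesis degA_gt0 : forall v, v \notin A -> (0 < degA v)%N.
Hypothesis degA_half : forall v, v \notin A -> (2 * degA v <= #|A|)%N.

Lemma degA_le5 v : v \notin A -> (degA v <= 5)%N.
Proof.
move=> vA; have := @star_ineq v set0 1 vA (sub0set _) ler01.
rewrite /weight big_set0 cards0 !mul1r expr1n addr0 leqNgt => h;
  apply/negP => q6.
have := degA_half vA; move: h q6 A39; rewrite -!(ler_nat R) !natrM !natrD.
set q := (degA v)%:R; set a := #|A|%:R => h q6 a39 qa.
have a4 : 0 < a + 4%:R by lra.
have : 0 <= (4 - q) * (a + 4%:R) + (q + 2%:R) ^+ 2.
  apply: le_trans (mulr_ge0 h (ltW a4)) _; rewrite le_eqVlt; apply/orP; left.
  by apply/eqP; field; rewrite gt_eqF.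
(* Added to the previous inequality, this product gives 56 - 2a >= 0, against a >= 39. *)
have : 0 <= (q - 6) * (a - q - 6) by apply: mulr_ge0; lra.
nra.
Qed.

Lemma sqr_divA (t : R) : t ^+ 2 / (#|A| + 4)%:R <= t ^+ 2 / 43.
Proof.
rewrite ler_wpM2l ?sqr_ge0 // lef_pV2 ?posrE ?ltr0n ?addnS //.
by rewrite (ler_nat _ 43); lia.
Qed.

Lemma weight_ub m (Z : {set T}) : (forall z, z \in Z -> (degA z <= m)%N) ->
  (weight Z <= (m + 2) * #|Z|)%N.
Proof.
by move=> hZ; rewrite mulnC -sum_nat_const leq_sum // => z /hZ;
  rewrite leq_add2r.
Qed.

Lemma weight_lb (Z : {set T}) : [disjoint Z & A] -> (3 * #|Z| <= weight Z)%N.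
Proof.
move=> ZA; rewrite mulnC -sum_nat_const leq_sum // => z zZ.
by have := degA_gt0 (negbT (disjointFr ZA zZ)); lia.
Qed.

Lemma nb_disjoint p : p \in A -> [disjoint nb p & A].
Proof.
move=> pA; rewrite disjoint_subset; apply/subsetP => z; rewrite !inE => pz.
by apply: contraTN pz; apply: A_indep.
Qed.

(** For seven such neighbours of total weight W, [common_ineq] with P = {p} gives W^2 / 43 - W >= 0,
    impossible for 21 <= W <= 42. *)
Lemma card_nb_low p : p \in A -> (#|[set z in nb p | (degA z <= 4)%N]| <= 6)%N.
Proof.
move=> pA; rewrite leqNgt; apply/negP => /subset_of_card[Z sZ cZ].
have Zlow z : z \in Z -> e p z /\ (degA z <= 4)%N.
  by move/(subsetP sZ); rewrite !inE => /andP[].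
have ZA : [disjoint Z & A].
  apply: disjointWl (nb_disjoint pA); apply/subsetP => z /Zlow[].
  by rewrite inE.
have pP q z : q \in [set p] -> z \in Z -> e q z by rewrite inE => /eqP->
  /Zlow[].
have := common_ineq (P := [set p]) _ ZA pP; rewrite sub1set pA => /(_ isT).
have := weight_ub (m := 4) (fun z zZ => proj2 (Zlow z zZ));
  have := weight_lb ZA.
rewrite cards1 cZ; set W := weight Z => h1 h2.
have := sqr_divA W%:R; have {}h1 : 21 <= W%:R :> R by rewrite (ler_nat _ 21);
  lia.
have {}h2 : W%:R <= 42 :> R by rewrite (ler_nat _ _ 42); lia.
set q := _ / (_ + 4)%:R; nra.
Qed.

(* The coefficient [j / 2] at the centre comes close to optimal in all cases. *)
Lemma card_nbY_lt y (m j : nat) : y \notin A ->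
  (forall z, z \notin A -> (degA z <= m)%N) ->
  (forall W : R, (3 * j)%:R <= W -> W <= ((m + 2) * j)%:R ->
    (4 - (degA y)%:R) * (j%:R / 2) ^+ 2 + 6 * j%:R - W - 4 * (j%:R / 2) * j%:R
     + (j%:R / 2 * (degA y + 2)%:R + W) ^+ 2 / 43 < 0) ->
  (#|nb y :\: A| < j)%N.
Proof.
move=> yA hm hW; rewrite ltnNge; apply/negP => /subset_of_card[Z sZ cZ].
have ZA z : z \in Z -> z \notin A by move/(subsetP sZ); rewrite inE => /andP[].
have Zd : [disjoint Z & A] by rewrite disjoint_subset; apply/subsetP => z /ZA.
have b0 : 0 <= j%:R / 2 :> R by rewrite divr_ge0 ?ler0n.
have := star_ineq yA sZ b0; rewrite cZ.
have := weight_ub (fun z zZ => hm z (ZA z zZ)); have := weight_lb Zd;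
  rewrite cZ.
rewrite -(ler_nat R) => h1; rewrite -(ler_nat R) => h2; have := hW _ h1 h2.
have := sqr_divA (j%:R / 2 * (degA y + 2)%:R + (weight Z)%:R).
set q := _ / (_ + 4)%:R; set q' := _ / 43; lra.
Qed.

Lemma card_nb_split v : (#|nb v| = degA v + #|nb v :\: A|)%N.
Proof. by rewrite -(cardsID A). Qed.

Lemma card_nb4 y : (forall z, z \notin A -> (degA z <= 4)%N) -> y \notin A ->
  degA y = 4%N -> (#|nb y| <= 8)%N.
Proof.
move=> h4 yA dy; rewrite card_nb_split dy.
suff : (#|nb y :\: A| < 5)%N by lia.
(* The expression is convex in [W], so its negativity comes down to the ends 15 and 30. *)
by apply: (card_nbY_lt yA h4) => W; rewrite dy; nra.
Qed.

(** A vertex of [A] has only neighbours of low [degA], so [card_nb_low] applies. Off [A], having 1,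
    2 or 3 neighbours in [A] leaves room for at most 5, 4 or 3 others. *)
Lemma card_nb3 v : (forall z, z \notin A -> (degA z <= 3)%N) -> (#|nb v| <=
  6)%N.
Proof.
move=> h3; have [vA|vA] := boolP (v \in A).
  apply: leq_trans (card_nb_low vA); apply/subset_leq_card/subsetP => z.
  rewrite !inE => vz; rewrite vz; apply: leq_trans (h3 z _) _ => //.
  by apply: contraTN vz; apply: A_indep.
have := degA_gt0 vA; have := h3 v vA; rewrite card_nb_split.
move: (erefl (degA v)); case: {2 3 4 5}(degA v) => [|[|[|[|d]]]] // dv _ _;
  rewrite ?dv.
- suff : (#|nb v :\: A| < 6)%N by lia.
  by apply: (card_nbY_lt vA h3) => W; rewrite dv; nra.
- suff : (#|nb v :\: A| < 5)%N by lia.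
  by apply: (card_nbY_lt vA h3) => W; rewrite dv; nra.
- suff : (#|nb v :\: A| < 4)%N by lia.
  by apply: (card_nbY_lt vA h3) => W; rewrite dv; nra.
Qed.

(** * A vertex with five neighbours in the independent set *)

Section DegreeFive.
Variable y : T.
Hypotheses (yA : y \notin A) (dy : degA y = 5%N).

Lemma cardA_le45 : (#|A| <= 45)%N.
Proof.
have := @star_ineq y set0 1 yA (sub0set _) ler01.
rewrite /weight big_set0 cards0 dy !mul1r expr1n addr0 -(ler_nat R).
have a0 : 0 < (#|A| + 4)%:R :> R by rewrite ltr0n addnS.
move=> h; have {h} : 1 <= 7 ^+ 2 / (#|A| + 4)%:R :> R by lra.
rewrite ler_pdivlMr // mul1r natrD; lra.
Qed.

Lemma nbY5 : nb y \subset A.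
Proof.
apply/subsetP => z; rewrite inE => yz; apply: contraT => zA.
have sZ : [set z] \subset nb y :\: A by rewrite sub1set !inE zA.
(* The coefficient 7 works for every [degA z] from 1 to 5: the bound is -74 + 52^2 / 43 at 1 and -78
   + 56^2 / 43 at 5, both negative, and it is convex in between. *)
have := star_ineq yA sZ (ler0n R 7); have := sqr_divA (7 * 7 + (degA z + 2)%:R).
rewrite /weight big_set1 cards1 dy.
have := degA_gt0 zA; have := degA_le5 zA; rewrite -(ler_nat R) => h1.
rewrite -(ler_nat R) => h2; set q := _ / (_ + 4)%:R.
rewrite !natrD; set d := (degA z)%:R in h1 h2 *; nra.
Qed.

(** At most six neighbours have [degA] below five. By [common_ineq], two vertices of [A] share at
    most one neighbour with [degA] five, since 12 - 14 - 4 + 14^2 / 43 < 0. Each such neighbour of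
    [p] thus claims four vertices of [A :\ p] of its own, and [#|A| <= 45] leaves at most eleven. *)
Lemma card_nb_p5 p : p \in A -> (#|nb p| <= 17)%N.
Proof.
move=> pA; pose X := [set z in nb p | degA z == 5%N].
have -> : nb p = [set z in nb p | (degA z <= 4)%N] :|: X.
  apply/setP => z; rewrite !inE; case: (boolP (e p z)) => //= pz.
  have := degA_le5 (contraTN (A_indep pA) pz); lia.
suff cX : (#|X| <= 11)%N.
  by apply: leq_trans (leq_card_setU _ _) _; exact: leq_add (card_nb_low pA) cX.
have XA z : z \in X -> z \notin A.
  by rewrite !inE => /andP[pz _]; apply: contraTN pz; apply: A_indep.
have cnt q : q \in A :\ p -> (#|nb q :&: X| <= 1)%N.
  rewrite !inE => /andP[qp qA]; rewrite leqNgt;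
    apply/negP => /subset_of_card[Z sZ cZ].
  have Z5 z : z \in Z -> [/\ e q z, e p z & degA z = 5%N].
    by move/(subsetP sZ); rewrite !inE => /and3P[-> -> /eqP].
  have ZA : [disjoint Z & A].
    rewrite disjoint_subset; apply/subsetP => z /(subsetP sZ);
      rewrite inE => /andP[_].
    exact: XA.
  have PA : [set p; q] \subset A by rewrite subUset !sub1set pA.
  have PZ r z : r \in [set p; q] -> z \in Z -> e r z.
    by rewrite !inE => /orP[]/eqP-> /Z5[].
  have cP : #|[set p; q]| = 2%N by rewrite cards2 eq_sym qp.
  have := common_ineq PA ZA PZ; rewrite cP cZ.
  have -> : weight Z = 14%N.
    by rewrite /weight (eq_bigr (fun=> 7%N)) => [|z /Z5[_ _ ->]] //;
      rewrite sum_nat_const cZ.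
  have := sqr_divA 14; set r := _ / (_ + 4)%:R; lra.
have : (\sum_(z in X) #|nb z :&: (A :\ p)| <= \sum_(q in A :\ p) 1)%N.
  by rewrite double_count leq_sum.
rewrite sum1_card (eq_bigr (fun=> 4%N)) => [|z zX]; last first.
  have /andP[pz /eqP] : e p z && (degA z == 5%N) by move: zX; rewrite !inE.
  rewrite /degA (cardsD1 p) !inE e_sym pz pA /= => -[]; rewrite setIDA => <-.
  by apply: eq_card => q; rewrite !inE.
have := cardsD1 p A; rewrite pA sum_nat_const; have := cardA_le45; lia.
Qed.

End DegreeFive.

Hypothesis n277 : (277 <= #|T|)%N.
Hypothesis edge_tf : forall v w, e v w -> triangle_free_on e (~: clnb [set v;
  w]).

Lemma edge_triangle_free (F : {set T}) v w : v \in F -> w \in F -> e v w ->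
  triangle_free_on e (~: clnb F).
Proof.
move=> vF wF vw a b c; have sub z : z \in ~: clnb F -> z \in ~: clnb [set v; w].
  have sF : [set v; w] \subset F by rewrite subUset !sub1set vF.
  rewrite !in_setC; apply: contra => /setUP[/(subsetP sF) zF|/bigcupP[x xF zx]].
    by apply/setUP; left.
  by apply/setUP; right; apply/bigcupP; exists x => //; apply: (subsetP sF).
by move=> /sub aF /sub bF /sub cF; apply: (edge_tf vw).
Qed.

Lemma heavy_small_nullity (F : {set T}) : heavy R e F -> (#|clnb F| <= 29)%N ->
  triangle_free_on e (~: clnb F) -> small_nullity R e.
Proof.
case=> u [_ uF su qu] cF tf;
  apply: (small_nullity_psd e_sym e_irr n277 cF _ tf).
exact: (psd_outside e_sym psdP uF su qu).
Qed.

(** Each member of [Z] has [y] among its at most [m.+1] neighbours, hence adds at most [m] vertices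
    to [y] and its neighbours. *)
Lemma card_clnb_star y (Z : {set T}) m : Z \subset nb y ->
  (forall p, p \in Z -> (#|nb p| <= m.+1)%N) ->
  (#|clnb (y |: Z)| <= #|nb y| + 1 + #|Z| * m)%N.
Proof.
move=> sZ hm.
have sub : clnb (y |: Z) \subset (y |: nb y) :|: \bigcup_(p in Z) (nb p :\ y).
  apply/subsetP => w /setUP[/setU1P[->|/(subsetP sZ) wy]|/bigcupP[p]].
  - by rewrite !inE eqxx.
  - by rewrite in_setU in_setU1 wy orbT.
  case/setU1P=> [->|pZ] wp; first by rewrite in_setU in_setU1 wp orbT.
  have [->|wy] := eqVneq w y; first by rewrite !inE eqxx.
  by apply/setUP; right; apply/bigcupP; exists p; rewrite // in_setD1 wy.
apply: leq_trans (subset_leq_card sub) _;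
  apply: leq_trans (leq_card_setU _ _) _.
apply: leq_add; first by rewrite cardsU1 addnC leq_add2l; case: (_ \notin _).
rewrite -sum_nat_const; elim/big_rec2: _ => [|p k B pZ IH];
  first by rewrite cards0.
apply: leq_trans (leq_card_setU _ _) _; apply: leq_add IH.
have := hm p pZ; rewrite (cardsD1 y (nb p)).
have -> // : y \in nb p by have := subsetP sZ p pZ; rewrite !inE e_sym.
Qed.

Lemma star_supported y (Z : {set T}) (b : R) :
  supported (y |: Z) (fun v => ind Z v + b * (v == y)%:R).
Proof.
move=> v; rewrite !inE negb_or => /andP[/negPf-> /negPf vZ].
by rewrite /ind vZ mulr0 addr0.
Qed.

Lemma star_sum_gt0 y (Z : {set T}) (b : R) : 0 < b ->
  0 < \sum_v (ind Z v + b * (v == y)%:R).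
Proof.
move=> b0; have t0 v : 0 <= ind Z v + b * (v == y)%:R.
  by rewrite addr_ge0 ?mulr_ge0 ?ler0n // ltW.
rewrite (bigD1 y) //= ltr_wpDr ?sumr_ge0 // eqxx mulr1 ltr_wpDl // ?ler0n.
Qed.

(** Weights 2 at the centre and 1 on four leaves form the null vector of affine D4. *)
Lemma star4_heavy y (Z : {set T}) : Z \subset nb y -> #|Z| = 4%N ->
  heavy R e (y |: Z).
Proof.
move=> sZ cZ; exists (fun v => ind Z v + 2 * (v == y)%:R); split.
- by move=> v; rewrite addr_ge0 ?mulr_ge0 ?ler0n.
- exact: star_supported.
- by apply: star_sum_gt0; lra.
- by have := qform_star 2 sZ; rewrite cZ; lra.
Qed.

Lemma star4_small_nullity y (Z : {set T}) m : Z \subset nb y -> #|Z| = 4%N ->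
  (forall p, p \in Z -> (#|nb p| <= m.+1)%N) -> (#|nb y| + 1 + 4 * m <= 29)%N ->
  small_nullity R e.
Proof.
move=> sZ cZ hm le29; apply: heavy_small_nullity (star4_heavy sZ cZ) _ _.
  by apply: leq_trans (card_clnb_star sZ hm) _; rewrite cZ.
have [p pZ] : exists p, p \in Z by apply/card_gt0P; rewrite cZ.
apply: (@edge_triangle_free _ y p); rewrite ?inE ?eqxx ?pZ ?orbT //.
by have := subsetP sZ p pZ; rewrite inE.
Qed.

Theorem large_independent_small_nullity : small_nullity R e.
Proof.
have [y /andP[yA /eqP dy]|no5] := pickP (fun y => (y \notin A) && (degA y ==
  5%N)).
  have cy : #|nb y| = 5%N by rewrite -dy /degA (setIidPl (nbY5 yA dy)).
  (* The weight 5/2 at the centre makes the form at most 10 - 25 + 25/2 < 0, and the closed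
     neighbourhood has at most 5 + 1 + 5 * 16 = 86 vertices. *)
  apply: (@small_nullity_strict R T e e_sym (y |: nb y)
    (fun v => ind (nb y) v + 5 / 2 * (v == y)%:R)) => //.
  - apply: leq_trans (@card_clnb_star y (nb y) 16 (subxx _) _) _;
    last by rewrite cy.
    by move=> p py; apply: (card_nb_p5 yA dy); apply: (subsetP (nbY5 yA dy)).
  - exact: star_supported.
  - by apply: star_sum_gt0; lra.
  - by have := qform_star (5 / 2) (subxx (nb y)); rewrite cy; lra.
have h4 z : z \notin A -> (degA z <= 4)%N.
  by move=> zA; have := degA_le5 zA; have := no5 z; rewrite zA /=; lia.
have [y /andP[yA /eqP dy]|no4] := pickP (fun y => (y \notin A) && (degA y ==
  4%N)).
  (* The count 8 + 1 + 4 * 5 is exactly the allowed 29. *)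
  apply: (@star4_small_nullity y (nb y :&: A) 5 (subsetIl _ _) dy).
    move=> p /setIP[_ pA]; apply: leq_trans (card_nb_low pA).
    apply/subset_leq_card/subsetP => z; rewrite !inE => pz; rewrite pz h4 //.
    by apply: contraTN pz; apply: A_indep.
  by have := card_nb4 h4 yA dy; lia.
have h3 z : z \notin A -> (degA z <= 3)%N.
  by move=> zA; have := h4 z zA; have := no4 z; rewrite zA /=; lia.
have deg6 v := card_nb3 v h3.
have [tf|ntf] := pselect (triangle_free_on e setT); last first.
  have [a [b [c /and3P[ab bc ca]]]] : exists a b c, [&& e a b, e b c & e c a].
    apply: contrapT => no; apply: ntf => a b c _ _ _; apply/negP => abc.
    by apply: no; exists a, b, c.
  have ne x z : e x z -> x != z by move=> xz; apply: contraTneq xz => ->;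
    rewrite e_irr.
  (* A triangle is affine A2. Seen as a star at [a] with two further vertices, it has at most 6 + 1
     + 2 * 5 vertices in its closed neighbourhood. *)
  have im : immersed e a [:: a; b; c] [:: (0, 1); (1, 2); (2, 0)]%N [:: 1; 1;
    1]%N.
    by rewrite /immersed /= !inE ab bc ca (ne _ _ ab) (ne _ _ bc) (ne _ _ ca).
  have sZ : [set b;
    c] \subset nb a by rewrite subUset !sub1set !inE ab e_sym ca.
  have FE : [set v in [:: a; b; c]] = a |: [set b; c] by apply/setP => z;
    rewrite !inE.
  have hF := immersed_heavy R e_sym im; rewrite FE in hF.
  apply: (heavy_small_nullity hF).
    apply: leq_trans (card_clnb_star (m := 5) sZ _) _ => //.
    by have := deg6 a; rewrite cards2; case: (_ != _); lia.
  by apply: edge_triangle_free ab; rewrite !inE eqxx ?orbT.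
have tfF (F : {set T}) : triangle_free_on e F by move=> a b c _ _ _;
  apply: tf; rewrite inE.
have [y y4|no_deg4] := pickP (fun y => 4 <= #|nb y|)%N.
  have [Z sZ cZ] := subset_of_card y4.
  by apply: (star4_small_nullity (m := 5) sZ cZ) => //; have := deg6 y; lia.
have deg3 v : (#|nb v| <= 3)%N by rewrite leqNgt no_deg4.
have [light|] := pselect (forall F, (#|clnb F| <= 29)%N -> ~ heavy R e F).
  apply: (@small_nullity_psd R T e e_sym e_irr set0) => //;
    first by rewrite cards0.
  have cl : nb_closed e setT by move=> v w _ _; rewrite inE.
  by rewrite setC0; exact: (subcubic_psd e_sym deg3 light cl).
move=> notlight; apply: contrapT => no; apply: notlight => F cF hF.
by apply: no; apply: heavy_small_nullity hF cF (tfF _).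
Qed.

End LargeIndependentSet.

(** * The Rayleigh bound from the smallest eigenvalue *)

Section Spectral.
Local Open Scope sesquilinear_scope.
Local Open Scope complex_scope.

(** The complexification of [S] is hermitian, so it is unitarily diagonalisable with real
    eigenvalues, and these are eigenvalues of [S] because the characteristic polynomial commutes
    with the embedding. In the eigenbasis the inequality holds coordinate by coordinate. *)
Lemma rayleigh_ge (R : rcfType) (n : nat) (S : 'M[R]_n) (a : R) : S^T = S ->
  (forall b, eigenvalue S b -> a <= b) ->
  forall x : 'rV[R]_n, a * (x *m x^T) 0 0 <= (x *m S *m x^T) 0 0.
Proof.
move=> Ssym Sa x; pose toC := GRing.RMorphism.clone _ _ (real_complex R) _.
pose A := map_mx toC S; pose P := spectralmx A; pose d := spectral_diag A.
have Areal m k (M : 'M[R]_(m, k)) : map_mx toC M \is a mxOver Num.real.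
  by apply/mxOverP => i j; rewrite mxE; apply/complex_realP; exists (M i j).
have Aherm : A \is hermsymmx.
  apply: realsym_hermsym; last exact: Areal.
  apply/is_hermitianmxP; rewrite expr0 scale1r map_mx_id //.
  by rewrite /A map_trmx Ssym.
have Pu : P \is unitarymx := spectral_unitarymx A.
have PV : invmx P = P^t* := invmx_unitary Pu.
have AE : A = P^t* *m diag_mx d *m P.
  by rewrite -PV; exact/orthomx_spectralP/hermitian_normalmx.
have dE i : exists2 r : R, d 0 i = toC r & a <= r.
  have /mxOverP/(_ 0 i)/complex_realP[r dr] := hermitian_spectral_diag_real
    Aherm.
  exists r => //; apply: Sa; rewrite eigenvalue_root_char -(fmorph_root toC).
  rewrite map_char_poly -eigenvalue_root_char; apply/eigenvalueP;
    exists (row i P).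
    rewrite -row_mul -/A AE !mulmxA (unitarymxP Pu) mul1mx.
    rewrite -[toC r]/(r%:C) -dr.
    by apply/rowP => j; rewrite mul_diag_mx !mxE.
  apply/negP => /eqP r0; have := congr1 (row i) (mulmxV (spectral_unit A)).
  rewrite row_mul -/P r0 mul0mx => /rowP/(_ i); rewrite !mxE eqxx => /esym/eqP.
  by rewrite oner_eq0.
pose x' := map_mx toC x; pose y := x' *m P^t*.
have x'C : x'^T = x'^t* by rewrite [RHS]realmxC // /x' map_trmx.
have yE : P *m x'^T = y^t*.
  rewrite /y x'C trmx_mul map_mxM; congr (_ *m _).
  by apply/matrixP => i j; rewrite !mxE; exact: esym (conjCK _).
have normE : toC ((x *m x^T) 0 0) = \sum_i y 0 i * (y 0 i)^*.
  transitivity ((y *m y^t*) 0 0); last first.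
    by rewrite mxE; apply: eq_bigr => i _; rewrite !mxE.
  rewrite -yE /y mulmxA mulmxKtV // map_trmx -map_mxM [RHS]mxE //.
have quadE : toC ((x *m S *m x^T) 0 0) = \sum_i d 0 i * (y 0 i * (y 0 i)^*).
  transitivity ((y *m diag_mx d *m y^t*) 0 0); last first.
    rewrite mxE; apply: eq_bigr => i _; rewrite mul_mx_diag !mxE; ring.
  have -> : y *m diag_mx d *m y^t* = x' *m A *m x'^T by rewrite -yE AE /y
    !mulmxA.
  by rewrite map_trmx -!map_mxM [RHS]mxE.
rewrite -lecR -/(toC _) -[(_ * _)%:C]/(toC _) rmorphM normE [X in _ <= X]quadE
  mulr_sumr.
apply: ler_sum => i _; have [r -> ar] := dE i.
by rewrite ler_wpM2r ?mul_conjC_ge0 // lecR.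
Qed.

End Spectral.

(** * Rank from a set that meets the support of every nonzero null vector *)

Section Rank.
Variables (R : realFieldType) (n : nat).

Lemma mulmx_form (M : 'M[R]_n) (x : 'rV[R]_n) :
  (x *m M *m x^T) 0 0 = \sum_i \sum_j M i j * x 0 i * x 0 j.
Proof.
rewrite mxE exchange_big /=; apply: eq_bigr => j _; rewrite !mxE mulr_suml.
by apply: eq_bigr => i _; rewrite [M i j * _]mulrC.
Qed.

(** Appending to [M] the coordinate columns indexed by [H] kills the left kernel, so the enlarged
    matrix has rank [n], while the new columns add at most [#|H|]. *)
Lemma rank_ge_hitting (M : 'M[R]_n) (H : {set 'I_n}) :
  (forall x : 'rV[R]_n, x *m M = 0 -> (forall i, i \in H -> x 0 i = 0) -> x =
    0) ->
  (n <= \rank M + #|H|)%N.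
Proof.
move=> hH; pose E : 'M[R]_(n, #|H|) := \matrix_(i, j) (i == enum_val j)%:R.
have : row_free (row_mx M E).
  apply: inj_row_free => x; rewrite mul_mx_row -row_mx0 => /eq_row_mx[xM xE].
  apply: hH => // i iH; have /rowP/(_ (enum_rank_in iH i)) := xE.
  rewrite !mxE (bigD1 i) //= mxE enum_rankK_in // eqxx mulr1 big1 ?addr0 // =>
    k ki.
  by rewrite mxE enum_rankK_in // (negPf ki) mulr0.
rewrite /row_free -mxrank_tr tr_row_mx => /eqP rn; rewrite -[leqLHS]rn -addsmxE.
apply: leq_trans (leq_of_leqif (mxrank_adds_leqif _ _)) _.
by rewrite !mxrank_tr leq_add2l rank_leq_col.
Qed.

End Rank.

(** * Switching graphs and sign conjugates of the Seidel matrix *)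

Section Switching.
Variables (R : realType) (n : nat) (S : 'M[R]_n).
Hypothesis hS : is_Seidel S.

Let S_sym i j : S i j = S j i.
Proof. by case: hS => /matrixP/(_ i j); rewrite mxE. Qed.

Let S_diag i : S i i = 0. Proof. by case: hS. Qed.

Let S_off i j : i != j -> S i j = 1 \/ S i j = -1.
Proof. by case: hS => _ _; apply. Qed.

Let eq1N : (1 == -1 :> R) = false.
Proof. by rewrite eq_sym eqNr oner_eq0. Qed.

(* The two copies of [i] in the switching graph; [true] is the negated one. *)
Definition vertex (s : bool) (i : 'I_n) : 'I_(n + n) :=
  if s then rshift n i else lshift n i.
Definition base (u : 'I_(n + n)) : 'I_n :=
  match split u with inl i => i | inr i => i end.
Definition side (u : 'I_(n + n)) : bool := if split u is inr _ then true else
  false.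

Lemma vertexK s i : base (vertex s i) = i.
Proof. by rewrite /base /vertex; case: s;
  rewrite ?(unsplitK (inr _)) ?(unsplitK (inl _)). Qed.

Lemma vertex_base u : vertex (side u) (base u) = u.
Proof.
rewrite -[RHS]splitK /vertex /side /base.
by case: (split u).
Qed.

Lemma switching_adj s t i j : switching_graph S (vertex s i) (vertex t j) =
  (i != j) && ((-1) ^+ s * (-1) ^+ t * S i j == -1).
Proof.
rewrite /switching_graph /seidel_graph /switching_mx /vertex.
have n0 : (0 == -1 :> R) = false by rewrite eq_sym oppr_eq0 oner_eq0.
have [->|ij] := eqVneq i j.
  by case: s t => [] [];
    rewrite ?block_mxEul ?block_mxEur ?block_mxEdl ?block_mxEdr
    ?mxE S_diag ?eqxx ?oppr0 ?add0r ?n0 ?eq1N.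
case: s t => [] []; rewrite ?block_mxEul ?block_mxEur ?block_mxEdl ?block_mxEdr
    ?mxE ?(negPf ij) ?mulr0n ?addr0 ?expr1 ?expr0 ?mulrNN ?mul1r ?mulr1 ?mulN1r
      //.
Qed.

Section Graph.
Variable sigma : 'I_n -> bool.

Definition sg i : R := (-1) ^+ sigma i.
(** The graph of a sign conjugate of [S]; by [switched_vertex] it is the switching graph induced on
    one copy of each index. *)
Definition switched : rel 'I_n := fun i j => (i != j) && (sg i * sg j * S i j
  == -1).

Lemma switched_sym : symmetric switched.
Proof. by move=> i j; rewrite /switched eq_sym S_sym [sg i * _]mulrC. Qed.

Lemma switched_irr : irreflexive switched.
Proof. by move=> i; rewrite /switched eqxx. Qed.

Lemma sg_sqr i : sg i * sg i = 1.
Proof. by rewrite /sg; case: (sigma i); rewrite ?mulrNN ?mulr1. Qed.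

Lemma switched_entry i j :
  sg i * sg j * (S + 5%:M) i j = 1 + 4 * (i == j)%:R - 2 * (switched i j)%:R.
Proof.
rewrite !mxE /switched; have [->|ij] := eqVneq i j.
  by rewrite S_diag /= sg_sqr; ring.
rewrite /= mulr0n addr0; case: (S_off ij) => ->; rewrite /sg.
  by case: (sigma i) (sigma j) => [] [];
    rewrite ?expr0 ?expr1 ?mulr1 ?mulrN1 ?opprK ?eqxx ?eq1N /=; lra.
by case: (sigma i) (sigma j) => [] [];
  rewrite ?expr0 ?expr1 ?mulr1 ?mulrN1 ?opprK ?eqxx ?eq1N /=; lra.
Qed.

Lemma pform_switched (x : 'I_n -> R) :
  pform switched x =
  ((\row_i (sg i * x i)) *m (S + 5%:M) *m (\row_i (sg i * x i))^T) 0 0.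
Proof.
rewrite mulmx_form /pform /qform /bform.
transitivity (\sum_i \sum_j (1 + 4 * (i == j)%:R - 2 * (switched i j)%:R) * x i
  * x j).
  have -> : \sum_i x i * x i = \sum_i \sum_j (i == j)%:R * x i * x j.
    apply: eq_bigr => i _; rewrite (bigD1 i) //= eqxx mul1r big1 ?addr0 // => j.
    by rewrite eq_sym => /negPf->; rewrite !mul0r.
  have -> : \sum_i \sum_(j | switched i j) x i * x j =
     \sum_i \sum_j (switched i j)%:R * x i * x j.
    apply: eq_bigr => i _; rewrite big_mkcond; apply: eq_bigr => j _.
    by case: (switched i j); rewrite ?mul1r ?mul0r.
  rewrite expr2 mulr_suml mulrBr mulrA !mulr_sumr -sumrB -big_split;
    apply: eq_bigr => i _ /=.
  rewrite !mulr_sumr -sumrB -big_split; apply: eq_bigr => j _ /=; ring.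
apply: eq_bigr => i _; apply: eq_bigr => j _; rewrite -switched_entry !mxE;
  ring.
Qed.

Lemma pform_ge0 : smallest_eigenvalue S (-5) ->
  forall x : 'I_n -> R, 0 <= pform switched x.
Proof.
case=> _ hmin x; rewrite pform_switched mulmxDr mulmxDl mxE.
have St : S^T = S by case: hS.
have := rayleigh_ge St hmin (\row_i (sg i * x i)).
rewrite mul_mx_scalar -scalemxAl [X in _ + X]mxE.
by set p := (_ *m _) 0 0; set q := (_ *m _) 0 0; lra.
Qed.

Lemma edge_triangle_free_switched : (class_omega S <= 4)%N ->
  forall v w, switched v w -> triangle_free_on switched (~: clnb switched [set
    v; w]).
Proof.
move=> om v w vw a b c; rewrite !in_setC => aN bN cN.
apply/negP => /and3P[ab bc ca].
pose D := [set x in [:: a; b; c; v; w]].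
have ne x y : switched x y -> x != y by case/andP.
have far x : x \notin clnb switched [set v; w] ->
    [/\ x != v, x != w, ~~ switched v x & ~~ switched w x].
  move=> xN; split; apply: contra xN.
  - by move/eqP->; rewrite /clnb !inE eqxx.
  - by move/eqP->; rewrite /clnb !inE eqxx orbT.
  - by move=> h; apply/setUP; right; apply/bigcupP; exists v;
    rewrite !inE ?eqxx.
  - by move=> h; apply/setUP; right; apply/bigcupP; exists w;
    rewrite !inE ?eqxx ?orbT.
have [av aw nva nwa] := far a aN; have [bv bw nvb nwb] := far b bN.
have [cv cw nvc nwc] := far c cN.
have uD : uniq [:: a; b; c; v; w].
  by rewrite /= !inE !negb_or (ne _ _ ab) (ne _ _ bc) (ne _ _ vw) (eq_sym a c)
    (ne _ _ ca) av aw bv bw cv cw.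
(* Flipping the signs at [v] and [w] keeps their edge and turns the six nonadjacencies to the
   triangle into edges. *)
pose tau i := if i \in [set v; w] then ~~ sigma i else sigma i.
pose C := [set vertex (tau i) i | i in D].
have cC : #|C| = 5%N.
  rewrite card_in_imset => [|x y _ _ /(congr1 base)]; last by rewrite !vertexK.
  by rewrite cardsE; move/card_uniqP: uD => ->.
suff clq : is_clique (switching_graph S) C.
  have : (#|C| <= class_omega S)%N.
    exact: (leq_bigmax_cond (F := fun X : {set 'I_(n + n)} => #|X|)).
  by rewrite cC => /leq_trans/(_ om).
apply/forall_inP => _ /imsetP[x xD ->]; apply/forall_inP => _ /imsetP[y yD ->].
apply/implyP => nxy; have {nxy} xy : x != y by apply: contraNneq nxy => ->.
rewrite switching_adj xy /=.
have sgN i : (-1) ^+ (~~ sigma i) = - sg i :> R.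
  by rewrite /sg; case: (sigma i); rewrite ?expr0 ?expr1 ?opprK.
have opp i j : i != j -> ~~ switched i j -> sg i * sg j * S i j = 1.
  move=> ij; rewrite /switched ij /=.
  by rewrite /sg; case: (S_off ij) => ->; case: (sigma i) (sigma j) => [] [];
     rewrite ?expr0 ?expr1 ?mulr1 ?mulrN1 ?opprK ?eqxx ?eq1N.
have in3 z : z \in D -> z \notin [set v; w] -> z \in [:: a; b; c].
  by rewrite !inE; case: (z == a); case: (z == b); case: (z == c);
    case: (z == v); case: (z == w).
have far3 z : z \in [:: a; b; c] -> forall u, u \in [set v;
  w] -> ~~ switched u z.
  by move=> + u; rewrite !inE => /or3P[]/eqP-> /orP[]/eqP->.
rewrite /tau; have [xv|xv] := boolP (x \in [set v; w]);
  have [yv|yv] := boolP (y \in [set v; w]).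
- rewrite !sgN mulrNN; have : switched x y; last by case/andP.
  move: xv yv xy; rewrite !inE => /orP[]/eqP-> /orP[]/eqP->; rewrite ?eqxx //.
  by rewrite switched_sym.
- by rewrite sgN -/(sg y) !mulNr opp // far3 // in3.
- by rewrite sgN -/(sg x) mulrN mulNr opp // switched_sym far3 // in3.
- have : switched x y; last by case/andP.
  have := in3 x xD xv; have := in3 y yD yv;
    rewrite !inE => /or3P[]/eqP E1 /or3P[]/eqP E2;
   rewrite E1 E2 ?eqxx // in xy *; by rewrite // switched_sym.
Qed.

Lemma rank_switched : small_nullity R switched ->
  2 * n%:R / 3 + 1 <= (\rank (S + 5%:M)%R)%:R :> R.
Proof.
case=> H cH hH; have : (n <= \rank (S + 5%:M)%R + #|H|)%N.
  apply: rank_ge_hitting => x xM xH; apply/rowP => i; rewrite mxE.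
  have rE : \row_k (sg k * (sg k * x 0 k)) = x.
    by apply/rowP => k; rewrite mxE mulrA sg_sqr mul1r.
  have : sg i * x 0 i = 0.
    apply: (hH (fun k => sg k * x 0 k)) => [|k /xH ->]; last by rewrite mulr0.
    by rewrite pform_switched rE xM mul0mx mxE.
  by move/(congr1 ( *%R (sg i))); rewrite mulrA sg_sqr mul1r mulr0.
move: cH; rewrite card_ord; set r := \rank _; move: r #|H| => r h c1 c2.
have : (2 * n + 3 <= 3 * r)%N by lia.
by rewrite -(ler_nat R) natrD !natrM; lra.
Qed.

Lemma switched_vertex i j :
  switched i j = switching_graph S (vertex (sigma i) i) (vertex (sigma j) j).
Proof. by rewrite switching_adj. Qed.

End Graph.

(** * The choice of signs from a maximum independent set *)

Section MaximumIndependent.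
Variable A' : {set 'I_(n + n)}.
Hypothesis A'_indep : is_independent (switching_graph S) A'.
Hypothesis A'_card : (39 <= #|A'|)%N.
Hypothesis A'_max : forall B, is_independent (switching_graph S) B -> (#|B| <=
  #|A'|)%N.

Let A := [set base u | u in A'].

Let indepP u v : u \in A' -> v \in A' -> ~~ switching_graph S u v.
Proof. by move=> uA vA;
  move/forall_inP/(_ u uA)/forall_inP/(_ v vA): A'_indep. Qed.

(** Any vertex over another index is adjacent to exactly one of the two copies of an index, so an
    independent set containing both copies has no third element. *)
Lemma base_inj : {in A' &, injective base}.
Proof.
move=> u v uA vA uv; apply/eqP/negPn/negP => nuv.
have [w wA wuv] : exists2 w, w \in A' & w \notin [set u; v].
  apply/subsetPn/negP => /subset_leq_card; rewrite cards2 nuv => h.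
  by have := leq_trans A'_card h.
have sN : side v = ~~ side u.
  apply/eqP; rewrite -[_ == _]negbK; apply: contra nuv => h.
  by rewrite -(vertex_base u) -(vertex_base v) uv;
    case: (side u) (side v) h => [] [].
have bw : base w != base u.
  apply: contra wuv => /eqP bw; rewrite !inE -(vertex_base w) bw.
  have [<-|] := eqVneq (side u) (side w); first by rewrite vertex_base eqxx.
  move=> h; rewrite uv; have -> : side w = side v by rewrite sN;
    case: (side u) (side w) h => [] [].
  by rewrite vertex_base eqxx orbT.
have := indepP wA uA; have := indepP wA vA.
rewrite -(vertex_base w) -(vertex_base u) -(vertex_base v) !switching_adj -uv
  bw sN /=.
by case: (S_off bw) => ->; case: (side w) (side u) => [] [];
  rewrite ?expr0 ?expr1 ?mulr1 ?mulrN1 ?opprK ?eqxx.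
Qed.

Let sigma0 i := vertex true i \in A'.
Let cnt y (s : bool) :=
  #|[set i in A | (y != i) && ((-1) ^+ s * (-1) ^+ sigma0 i * S y i == -1)]|.
(** On [A] the copy lying in [A'] is chosen; off [A], where [cnt y s] counts the neighbours in [A]
    of copy [s], a copy adjacent to at most half of [A]. *)
Let sigma y := if y \in A then sigma0 y else (#|A| < 2 * cnt y false)%N.

Let e := switched sigma.

Let vertexA i : i \in A -> vertex (sigma i) i \in A'.
Proof.
move=> iA; rewrite /sigma iA /sigma0.
case: (boolP (vertex true i \in A')) => [//|/negPf ni].
case/imsetP: (iA) => u uA iu; have := uA; rewrite -(vertex_base u) -iu.
by case: (side u); rewrite ?ni.
Qed.

Let cardA : #|A| = #|A'|.
Proof. exact: card_in_imset base_inj. Qed.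

(** The two copies of [y] carry opposite signs, so each member of [A] is adjacent to exactly one of
    them. *)
Let cnt_sum y : y \notin A -> (cnt y true + cnt y false = #|A|)%N.
Proof.
move=> yA; rewrite /cnt; set X := [set i in A | _ && (_ * _ * _ == _)].
rewrite -(cardsID X A); congr (_ + _)%N; apply: eq_card => i; rewrite !inE;
  case: (boolP (i \in A)) => //= iA.
have yi : y != i by apply: contraNneq yA => ->.
rewrite yi /=; case: (S_off yi) => ->; case: (sigma0 i);
  by rewrite ?expr0 ?expr1 ?mulr1 ?mulrN1 ?opprK ?eqxx ?eq1N.
Qed.

Let degA_cnt y : y \notin A -> degA e A y = cnt y (sigma y).
Proof.
move=> yA; apply: eq_card => i; rewrite !inE /e /switched /sg andbC.
case: (boolP (i \in A)) => //= iA.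
by have -> : sigma i = sigma0 i by rewrite /sigma iA.
Qed.

Let degA_half y : y \notin A -> (2 * degA e A y <= #|A|)%N.
Proof.
move=> yA; rewrite degA_cnt // /sigma (negPf yA); have := cnt_sum yA.
by case: ltnP; move: (cnt y true) (cnt y false) #|A| => p q a; lia.
Qed.

Let A_indep v w : v \in A -> w \in A -> ~~ e v w.
Proof. by move=> vA wA; rewrite /e switched_vertex indepP ?vertexA. Qed.

(** Otherwise the chosen copy of [y] could be added to [A'], against maximality. *)
Let degA_gt0 y : y \notin A -> (0 < degA e A y)%N.
Proof.
move=> yA; rewrite lt0n; apply/negP => /eqP/cards0_eq d0.
have nadj u : u \in A' -> ~~ switching_graph S (vertex (sigma y) y) u.
  move=> uA; have bA : base u \in A by apply: imset_f.
  have -> : u = vertex (sigma (base u)) (base u).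
    by apply: base_inj; rewrite ?vertexK ?vertexA.
  rewrite -switched_vertex; apply/negP => yu; move/setP/(_ (base u)): d0.
  by rewrite !inE bA -/e /e yu.
have sym u v : switching_graph S u v = switching_graph S v u.
  rewrite -(vertex_base u) -(vertex_base v) !switching_adj eq_sym S_sym.
  by rewrite [(-1) ^+ side u * _]mulrC.
have : is_independent (switching_graph S) (vertex (sigma y) y |: A').
  apply/forall_inP => u /setU1P uA; apply/forall_inP => v /setU1P vA.
  case: uA => [->|uA]; case: vA => [->|vA].
  - by rewrite switching_adj eqxx.
  - exact: nadj.
  - by rewrite sym nadj.
  - exact: indepP.
move/A'_max; rewrite cardsU1; have -> : vertex (sigma y) y \notin A'.
  by apply: contra yA => h; rewrite -(vertexK (sigma y) y); apply: imset_f.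
by rewrite add1n ltnn.
Qed.

Lemma rank_from_independent : (277 <= n)%N -> smallest_eigenvalue S (-5) ->
  (class_omega S <= 4)%N -> 2 * n%:R / 3 + 1 <= (\rank (S + 5%:M)%R)%:R :> R.
Proof.
move=> hn hmin hom; apply: (@rank_switched sigma).
have A39 : (39 <= #|A|)%N by rewrite cardA.
have n277 : (277 <= #|'I_n|)%N by rewrite card_ord.
exact: (large_independent_small_nullity (@switched_sym sigma)
  (@switched_irr sigma) (pform_ge0 sigma hmin) A_indep A39 degA_gt0 degA_half
  n277 (edge_triangle_free_switched hom)).
Qed.

End MaximumIndependent.
End Switching.

Theorem theorem7p2 (R : realType) (n : nat) (S : 'M[R]_n)
  (hn : (277 <= n)%N)
  (hS : is_Seidel S)
  (hmin : smallest_eigenvalue S (-5))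
  (homega : class_omega S = 4%N)
  (halpha : (39 <= class_alpha S)%N) :
  2 * n%:R / 3 + 1 <= (\rank (S + 5%:M)%R)%:R :> R.
Proof.
have i0 : is_independent (switching_graph S) set0.
  by apply/forall_inP => x; rewrite inE.
have [A' iA' maxA'] := arg_maxnP (fun B : {set 'I_(n + n)} => #|B|) i0.
apply: (rank_from_independent hS iA' _ maxA' hn hmin); last by rewrite homega.
by apply: leq_trans halpha _; apply/bigmax_leqP.
Qed.
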